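(* Let $\mathfrak{A}$ be a finite type I von Neumann algebra acting on a complex Hilbert space $\mathcal{H}$. Then for any $T \in \mathfrak{A}$ the following conditions are equivalent: (a) $\|T\xi\| < \|\xi\|$ for each non-zero vector $\xi \in \mathcal{H}$; (b) there is a sequence $Z_1, Z_2, \ldots \in \mathcal{Z}(\mathfrak{A})$ of mutually orthogonal projections such that $\sum_{n=1}^{\infty} Z_n = I$ and $\|T Z_n\| < 1$ for every $n \geqslant 1$.
   Context: $\mathcal{Z}(\mathfrak{A})$ is the center of $\mathfrak{A}$, $I$ is the identity operator on $\mathcal{H}$, projections are orthogonal projections (possibly zero), and the series $\sum_n Z_n$ converges in the strong operator topology. *)

(* Defs.v *)
From HB Require Import structures.
From mathcomp Require Import all_boot all_order all_algebra.
From mathcomp Require Import complex.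
From mathcomp Require Import boolp classical_sets functions reals topology.
From mathcomp Require Import normedtype sequences.

Set Implicit Arguments.
Unset Strict Implicit.
Unset Printing Implicit Defensive.

Import Order.TTheory GRing.Theory Num.Theory.
Import numFieldNormedType.Exports.

Local Open Scope classical_set_scope.
Local Open Scope ring_scope.

(* A complex Hilbert space: the inner product (linear in its first argument,
   conjugate-linear in the second) induces the norm of a complete normed
   space over the complex numbers R[i]. *)
HB.mixin Record isHilbert (R : realType) H
    of CompleteNormedModule R[i] H := {
  inner : {dot H for Num.conj};
  inner_norm : forall x : H, inner x x = `|x| ^+ 2
}.

#[short(type="hilbertType")]
HB.structure Definition Hilbert (R : realType) :=
  {H of isHilbert R H & CompleteNormedModule R[i] H}.

Section Operators.
Context {R : realType} {H : hilbertType R}.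
Implicit Types (S T E F V : H -> H) (A : set (H -> H)).

Definition bounded_operator T := linear T /\ continuous T.

Definition is_adjoint T S := forall x y, inner (T x) y = inner x (S y).

(* Norms of vectors are nonnegative elements of R[i]; the operator norm is
   their supremum over the unit ball, taken in R. *)
Definition opnorm T : R :=
  sup [set complex.Re `|T x| | x in [set x : H | `|x| <= 1]].

Definition projection E :=
  [/\ bounded_operator E, E \o E = E & is_adjoint E E].

Definition proj_le F E := E \o F = F.

Definition commutant A : set (H -> H) :=
  [set T | bounded_operator T /\ forall S, A S -> T \o S = S \o T].

Definition vn_center A : set (H -> H) := A `&` commutant A.

Definition star_algebra A :=
  [/\ forall T, A T -> bounded_operator T,
      forall S T, A S -> A T -> A (S + T),
      forall (c : R[i]) T, A T -> A (c *: T),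
      forall S T, A S -> A T -> A (S \o T)
    & forall T, A T -> exists S, A S /\ is_adjoint T S].

(* The double commutant condition forces the identity to lie in A. *)
Definition von_neumann_algebra A :=
  star_algebra A /\ commutant (commutant A) = A.

(* Murray-von Neumann equivalence relative to A: E = V^* V and F = V V^*
   for some V in A. *)
Definition mvn_equiv A E F :=
  exists V W, [/\ A V, A W, is_adjoint V W, W \o V = E & V \o W = F].

Definition finite_projection A E :=
  forall F, A F -> projection F -> proj_le F E -> mvn_equiv A E F -> F = E.

Definition finite_algebra A := finite_projection A idfun.

(* The corner EAE is commutative. *)
Definition abelian_projection A E :=
  [/\ A E, projection E
    & forall S T, A S -> A T ->
        (E \o S \o E) \o (E \o T \o E) = (E \o T \o E) \o (E \o S \o E)].

Definition type_I A :=
  forall Z, vn_center A Z -> projection Z -> Z <> 0 ->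
    exists E, [/\ abelian_projection A E, proj_le E Z & E <> 0].

Definition sot_sum (Z : nat -> H -> H) T :=
  forall x, series (fun n => Z n x) @ \oo --> T x.

End Operators.

(* Main.v *)
Require Import Defs.
From mathcomp Require Import all_boot all_order all_algebra.
From mathcomp Require Import complex.
From mathcomp Require Import boolp classical_sets functions reals topology.
From mathcomp Require Import normedtype sequences.
From mathcomp Require Import ring lra.

Import Order.TTheory GRing.Theory Num.Theory.
Import numFieldNormedType.Exports.

Local Open Scope ring_scope.

(* Let b = 1 - T^*T, which is positive and, under (a), injective. The point is that
   below every nonzero central projection there is a nonzero central projection Q
   on which b >= e for some e > 0; the closed spans of the ranges of the central Q on
   which |T Q|^2 <= 1 - 1/(k+1) are then the ranges of central projections
   increasing to I, whose successive differences are the Z_n.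
   To find Q, take an abelian projection F below the given central projection.
   Finiteness bounds the number of orthogonal copies of F, since an infinite family
   would yield a shift isometry. The spectral projections C of b for [0, e] decrease
   strongly to 0 as e -> 0, so a trace estimate over the finitely many copies shows
   that a suitable part E of F is not subequivalent to C for small e. Comparison
   then gives E1 <= E with C A E1 = 0, so that b >= e on the central support of E1.
   Partial isometries in A are obtained as closures of isometric graphs invariant
   under the commutant of A, which reduces comparison to Zorn's lemma. *)

(** * Real inner product and convergence *)

(** The difficulty is that (a) gives [b] no uniform gap, and that spectral projections of [b] are in
    general not central. On l^2 the diagonal operator with entries [1 - 1/n] satisfies (a), while
    all bounded operators together have only the central projections 0 and I; so the gap cannot come
    from [b] alone, and finiteness must be used quantitatively. The estimate does so without a
    center-valued trace: it compares a sum over copies at one fixed vector, for which strong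
    convergence of the spectral projections is enough, and commutativity of the corner of an abelian
    projection plays the part of the trace identity. No functional calculus is used either.
    Injectivity of [b] enters as density of its range, square roots come from an iteration, and a
    spectral projection is cut out as the kernel of a sum [|X| + X], known only through two
    inequalities. *)

Section RealInner.
Context {R : realType} {H : hilbertType R}.
Implicit Types (x y z : H) (r : R).

(* [inner] at the type [R[i]], which its own type only unfolds to. *)
Let cin x y : R[i] := inner x y.
Let cinC x y : cin x y = conjc (cin y x).
Proof. by rewrite /cin hermC expr0 mul1r. Qed.
Let cinD x y z : cin (x + y) z = cin x z + cin y z.
Proof. exact: linearDl. Qed.
Let cinN x y : cin (- x) y = - cin x y.
Proof. exact: linearNl. Qed.
Let cinZ (c : R[i]) x y : cin (c *: x) y = c * cin x y.
Proof. exact: linearZl_LR. Qed.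

(* The whole argument is run in the underlying real inner product space: for
   linear operators, adjoints with respect to [rip] and to [inner] agree. *)
Definition rip x y : R := complex.Re (inner x y).
Definition nm x : R := complex.Re `|x|.

Let ripE_cin x y : rip x y = complex.Re (cin x y). Proof. by []. Qed.

Lemma normE x : `|x| = (nm x)%:C%C.
Proof. by rewrite /nm RRe_real// normr_real. Qed.

Lemma nm_ge0 x : 0 <= nm x.
Proof. by rewrite -ler0c -normE. Qed.

Lemma rip_nm x : rip x x = nm x ^+ 2.
Proof. by rewrite /rip inner_norm normE -rmorphXn. Qed.

Lemma ripC x y : rip x y = rip y x.
Proof. by rewrite !ripE_cin cinC; case: (cin y x). Qed.

Lemma ripDl x y z : rip (x + y) z = rip x z + rip y z.
Proof. by rewrite !ripE_cin cinD; case: (cin x z) => ? ?; case: (cin y z). Qed.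

Lemma ripDr x y z : rip x (y + z) = rip x y + rip x z.
Proof. by rewrite ripC ripDl !(ripC x). Qed.

Lemma ripNl x y : rip (- x) y = - rip x y.
Proof. by rewrite !ripE_cin cinN; case: (cin x y). Qed.

Lemma ripNr x y : rip x (- y) = - rip x y.
Proof. by rewrite ripC ripNl (ripC x). Qed.

Lemma ripBl x y z : rip (x - y) z = rip x z - rip y z.
Proof. by rewrite ripDl ripNl. Qed.

Lemma ripBr x y z : rip x (y - z) = rip x y - rip x z.
Proof. by rewrite ripDr ripNr. Qed.

Lemma ripZ (c : R[i]) x y : rip (c *: x) y = rip x (conjc c *: y).
Proof.
rewrite !ripE_cin cinZ [cin x (_ *: _)]cinC cinZ (cinC x).
by case: (cin y x) c => a b [c d] /=; ring.
Qed.

Lemma ripZl r x y : rip (r%:C%C *: x) y = r * rip x y.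
Proof.
rewrite !ripE_cin cinZ; case: (cin x y) => a b /=.
by rewrite mul0r subr0.
Qed.

Lemma ripZr r x y : rip x (r%:C%C *: y) = r * rip x y.
Proof. by rewrite ripC ripZl (ripC x). Qed.

Lemma rip0l x : rip 0 x = 0.
Proof. by rewrite -(subrr 0) ripBl subrr. Qed.

Lemma rip0r x : rip x 0 = 0.
Proof. by rewrite ripC rip0l. Qed.

Definition ripE := (ripDl, ripDr, ripNl, ripNr, ripZl, ripZr, rip0l, rip0r).

Lemma nm0 : nm 0 = 0.
Proof. by rewrite /nm normr0. Qed.

Lemma nm_eq0 x : nm x = 0 -> x = 0.
Proof. by move=> h; apply: normr0_eq0; rewrite normE h. Qed.

Lemma rip_ge0 x : 0 <= rip x x.
Proof. by rewrite rip_nm sqr_ge0. Qed.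

Lemma rip_eq0 x : rip x x = 0 -> x = 0.
Proof. by rewrite rip_nm => /eqP; rewrite sqrf_eq0 => /eqP/nm_eq0. Qed.

Lemma rip_inj x y : (forall z, rip x z = rip y z) -> x = y.
Proof.
by move=> h; apply/subr0_eq/rip_eq0; rewrite ripBl h subrr.
Qed.

(** The imaginary part of a complex number is the real part of its product with [-i], so [rip] at
    the multiples by 1 and [-i] recovers [inner]. *)
Lemma rip_inner (x y x' y' : H) :
  (forall c : R[i], rip (c *: x) y = rip (c *: x') y') ->
  inner x y = inner x' y'.
Proof.
move=> h; rewrite -!/(cin _ _).
have := h 1; have := h (0 -i* 1)%C; rewrite !ripE_cin !cinZ.
case: (cin x y) => a b; case: (cin x' y') => c d /= h1 h2.
by apply/eqP; rewrite eq_complex /=; apply/andP; split; apply/eqP; lra.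
Qed.

Lemma nmD x y : nm (x + y) <= nm x + nm y.
Proof. by have := ler_normD x y; rewrite !normE -rmorphD /= lecR. Qed.

Lemma nmN x : nm (- x) = nm x.
Proof. by rewrite /nm normrN. Qed.

Lemma nmB x y : nm (x - y) = nm (y - x).
Proof. by rewrite -nmN opprB. Qed.

Lemma nmZ r x : nm (r%:C%C *: x) = `|r| * nm x.
Proof.
rewrite /nm normrZ; set a := `|r%:C%C|.
have -> : a = (`|r|)%:C%C.
  by rewrite /a normc_def /= expr0n addr0 sqrtr_sqr.
by rewrite normE /=; rewrite mul0r subr0.
Qed.

Lemma nmZc (c : R[i]) x : nm (c *: x) = complex.Re `|c| * nm x.
Proof. by rewrite /nm normrZ !normc_def normE /=; ring. Qed.

Lemma nmc_ge0 (c : R[i]) : 0 <= complex.Re `|c|.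
Proof. by rewrite normc_def /= sqrtr_ge0. Qed.

Lemma nm_split x y : nm x <= nm (x - y) + nm y.
Proof. by rewrite -{1}(subrK y x) nmD. Qed.

Lemma nm_triangle x y z : nm (x - z) <= nm (x - y) + nm (y - z).
Proof. by have := nmD (x - y) (y - z); rewrite addrA subrK. Qed.

Lemma nm_le_sq x r : 0 <= r -> rip x x <= r ^+ 2 -> nm x <= r.
Proof. by move=> r0; rewrite rip_nm ler_sqr ?nnegrE ?nm_ge0. Qed.

Lemma nm_lt_sq x r : 0 <= r -> rip x x < r ^+ 2 -> nm x < r.
Proof. by move=> r0; rewrite rip_nm ltr_sqr ?nnegrE ?nm_ge0. Qed.

Lemma rip_CS x y : rip x y <= nm x * nm y.
Proof.
have [->|y0] := pselect (y = 0); first by rewrite rip0r nm0 mulr0.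
have ny : 0 < nm y.
  by rewrite lt_neqAle nm_ge0 andbT; apply/eqP => e; apply: y0; apply: nm_eq0.
(* Expanding this square gives [2 |x| |y| (|x| |y| - <x, y>) >= 0]. *)
have := rip_ge0 ((nm y)%:C%C *: x - (nm x)%:C%C *: y).
rewrite !ripE !rip_nm (ripC y x) => h.
have [|nx] := leP (nm x) 0.
  move=> h0; have -> : x = 0 by apply: nm_eq0; have := nm_ge0 x; lra.
  by rewrite rip0l nm0 mul0r.
have : 0 <= 2 * (nm x * nm y) * (nm x * nm y - rip x y) by nra.
by rewrite pmulr_rge0 ?subr_ge0// mulr_gt0// mulr_gt0.
Qed.

(* Closedness and convergence are phrased with real epsilons, away from the
   topology of [R[i]]. *)
Definition adh D x := forall e : R, 0 < e -> exists y, D y /\ nm (x - y) < e.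

Definition lims (u : nat -> H) x :=
  forall e : R, 0 < e -> exists n, forall p, (n <= p)%N -> nm (u p - x) < e.

Lemma lims_cvg (u : nat -> H) x : lims u x <-> (u @ \oo --> x)%classic.
Proof.
rewrite (cvgrPdistC_lt (F := \oo%classic) u x); split.
  move=> h e e0.
  have eR : e = (complex.Re e)%:C%C by rewrite RRe_real// gtr0_real.
  have e0' : 0 < complex.Re e by rewrite -ltcR -eR.
  have [n hn] := h _ e0'; exists n => // p /= np.
  by rewrite normE eR ltcR hn.
move=> h e e0; have := h e%:C%C; rewrite ltcR => /(_ e0) [n _ hn].
by exists n => p np; have := hn p np; rewrite /= normE ltcR.
Qed.

Lemma lims_cauchy (u : nat -> H) :
  (forall e : R, 0 < e -> exists n, forall p q, (n <= p)%N -> (n <= q)%N ->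
     nm (u p - u q) < e) ->
  exists x, lims u x.
Proof.
move=> h; suff : cvg (u @ \oo)%classic.
  by move=> c; exists (lim (u @ \oo)%classic); apply/lims_cvg.
apply/cauchy_cvgP/cauchy_ballP => e e0.
have eR : e = (complex.Re e)%:C%C by rewrite RRe_real// gtr0_real.
have e0' : 0 < complex.Re e by rewrite -ltcR -eR.
have [n hn] := h _ e0'.
exists (u @` [set p | (n <= p)%N], u @` [set p | (n <= p)%N])%classic.
  by split=> /=; exists n => // p /= np; exists p.
move=> [a b] /= [[p np <-] [q nq <-]].
by rewrite -ball_normE /ball_ /= normE eR ltcR hn.
Qed.

Lemma lims_adh (D : H -> Prop) x :
  adh D x -> exists u, (forall n, D (u n)) /\ lims u x.
Proof.
move=> h; have h' n : exists y, D y /\ nm (x - y) < n.+1%:R^-1.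
  by apply: h; rewrite invr_gt0.
have [u hu] := choice h'; exists u; split=> [n|e e0]; first by case: (hu n).
have [n hn] : exists n : nat, n.+1%:R^-1 < e.
  exists (Num.truncn e^-1).
  by rewrite invf_plt ?posrE// truncnS_gt.
exists n => p np; rewrite nmB; apply: lt_trans (hn).
case: (hu p) => _ /lt_le_trans; apply.
by rewrite lef_pV2 ?posrE// ler_nat.
Qed.

Lemma small (c e : R) : 0 < e -> exists d, 0 < d /\ c * d < e.
Proof.
move=> e0; exists (e / (`|c| + 1)).
have c0 : 0 < `|c| + 1 by rewrite ltr_wpDl.
split; first by rewrite divr_gt0.
rewrite mulrA ltr_pdivrMr// mulrC ltr_pM2l//.
by have := ler_norm c; lra.
Qed.

Lemma lims_unique u x y : lims u x -> lims u y -> x = y.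
Proof.
move=> hx hy; apply/subr0_eq/nm_eq0/eqP/negPn/negP => h.
have n0 : 0 < nm (x - y) / 2.
  by rewrite divr_gt0// lt_neqAle nm_ge0 eq_sym h.
have [n hn] := hx _ n0; have [m hm] := hy _ n0.
have := hn (maxn n m) (leq_maxl _ _); have := hm (maxn n m) (leq_maxr _ _).
by have := nm_triangle x (u (maxn n m)) y; rewrite (nmB x (u _)); lra.
Qed.

Lemma lims_le (u v : nat -> H) x y (M : R) : 0 <= M -> lims u x ->
  (forall n, nm (v n - y) <= M * nm (u n - x)) -> lims v y.
Proof.
move=> M0 hu h e e0; have [d [d0 hd]] := small M e e0.
have [n hn] := hu _ d0; exists n => p np; apply: le_lt_trans (h p) _.
apply: le_lt_trans hd; rewrite ler_wpM2l//.
exact/ltW/hn.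
Qed.

Lemma lims_nm (u : nat -> H) x (r : R) :
  lims u x -> (forall n, nm (u n) <= r) -> nm x <= r.
Proof.
move=> hu h; apply/ler_addgt0Pl => e e0; have [n hn] := hu _ e0.
have := hn n (leqnn n); have := h n; have := nm_split x (u n).
by rewrite (nmB x); lra.
Qed.

Lemma lims_rip_le (u v : nat -> H) x y z t : lims u x -> lims v t ->
  (forall n, rip (u n) y <= rip z (v n)) -> rip x y <= rip z t.
Proof.
move=> hu hv h; apply/ler_addgt0Pr => e e0; have e20 := divr_gt0 e0 (ltr0n _ 2).
have [d [d0 hd]] := small (nm y) _ e20; have [d' [d'0 hd']] := small (nm z) _ e20.
have [n hn] := hu _ d0; have [m hm] := hv _ d'0.
have := hn _ (leq_maxl n m); have := hm _ (leq_maxr n m); have := h (maxn n m).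
move: (u _) (v _) => a b h1 h2 h3.
have := rip_CS (x - a) y; have := rip_CS z (b - t).
rewrite ripBl ripBr (nmB x) => h4 h5.
have := ler_wpM2l (nm_ge0 y) (ltW h3); have := ler_wpM2l (nm_ge0 z) (ltW h2).
lra.
Qed.

End RealInner.

(** * Orthogonal projections *)

Section Subspaces.
Context {R : realType} {H : hilbertType R}.
Implicit Types (x y z : H) (K D : H -> Prop).

(** [Q d x] reads: [x] solves a problem up to [d]. When good approximate solutions are close to each
    other, those of defect [1/(n+1)] form a Cauchy sequence; its limit is approached by approximate
    solutions. *)
Lemma approx_lim (Q : R -> H -> Prop) :
  (forall d, 0 < d -> exists x, Q d x) ->
  (forall d d' x, d <= d' -> Q d x -> Q d' x) ->
  (forall e : R, 0 < e -> exists d, 0 < d /\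
     forall x y, Q d x -> Q d y -> nm (x - y) < e) ->
  exists p, forall e d, 0 < e -> 0 < d -> exists x, Q d x /\ nm (x - p) < e.
Proof.
move=> hex hmon hC; have h' n : exists x, Q n.+1%:R^-1 x by apply: hex; rewrite invr_gt0.
have [u hu] := choice h'.
have inv_lt d : 0 < d -> exists n, forall p, (n <= p)%N -> p.+1%:R^-1 <= d :> R.
  move=> d0; exists (Num.truncn d^-1) => p np.
  rewrite invf_ple ?posrE//; apply/ltW/(lt_le_trans (truncnS_gt _)).
  by rewrite ler_nat.
have [|p hp] := @lims_cauchy _ _ u.
  move=> e e0; have [d [d0 hd]] := hC _ e0; have [n hn] := inv_lt _ d0.
  by exists n => p q np nq; apply: hd; apply: hmon (hu _); apply: hn.
exists p => e d e0 d0; have [n hn] := hp _ e0; have [m hm] := inv_lt _ d0.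
exists (u (maxn n m)); split; last by apply: hn; rewrite leq_maxl.
by apply: hmon (hu _); apply: hm; rewrite leq_maxr.
Qed.

Definition subsp K :=
  K 0 /\ forall (c : R[i]) x y, K x -> K y -> K (c *: x + y).
(** The Riesz representation below concerns functionals that are only real-linear, whose kernels
    need not be complex subspaces. *)
Definition rsubsp K :=
  K 0 /\ forall (r : R) x y, K x -> K y -> K (r%:C%C *: x + y).
Definition csub K := subsp K /\ forall x, adh K x -> K x.

Lemma subsp_rsubsp K : subsp K -> rsubsp K.
Proof. by move=> [h0 h]; split=> // r x y; apply: h. Qed.

(** Near-minimizers of the distance to [K] cluster by the parallelogram law; at their limit the
    first variation of the squared distance vanishes in every direction of [K]. *)
Lemma rproj_exists K x : rsubsp K -> (forall x, adh K x -> K x) ->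
  exists p, K p /\ forall k, K k -> rip (x - p) k = 0.
Proof.
move=> [K0 KL] Kc.
pose S := [set nm (x - k) | k in K]%classic.
have Sinf : has_inf S.
  by split; [exists (nm (x - 0)), 0|exists 0 => _ [k _ <-]; exact: nm_ge0].
pose d := inf S.
have dk k : K k -> d <= nm (x - k).
  by move=> Kk; apply: ge_inf => //; [exact: Sinf.2|exists k].
have d0 : 0 <= d.
  by apply: lb_le_inf; [exact: Sinf.1|move=> _ [k _ <-]; exact: nm_ge0].
have [|||p hp] := approx_lim (fun e k => K k /\ nm (x - k) < d + e).
- move=> e e0; have [_ [k Kk <-] hk] := inf_adherent e0 Sinf.
  by exists k.
- by move=> e e' k ee' [Kk hk]; split=> //; lra.
(* The midpoint has distance at least [d], so [|k - k'|^2 <= 4 ((d + s)^2 - d^2)], which is at most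
   [4 (2 d + 1) s] once [s <= 1]; hence the constant and the cap at 1. *)
- move=> e e0; have [t [t0 ht]] := small (4 * (2 * d + 1)) (e ^+ 2) (exprn_gt0 2 e0).
  exists (Num.min t 1); rewrite lt_min t0 ltr01; split=> // k k' [Kk hk] [Kk' hk'].
  set s := Num.min t 1 in hk hk'.
  have s1 : s <= 1 by rewrite /s ge_min lexx orbT.
  have st : s <= t by rewrite /s ge_min lexx.
  have s0 : 0 < s by rewrite /s lt_min t0 ltr01.
  apply: nm_lt_sq; first exact: ltW.
  have Km : K ((2^-1)%:C%C *: (k - k') + k').
    have Kd : K (k - k').
      by have := KL (-1) k' k Kk' Kk; rewrite rmorphN1 scaleN1r addrC.
    exact: KL.
  have := dk _ Km; have := nm_ge0 (x - k); have := nm_ge0 (x - k').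
  have : rip (k - k') (k - k') = 2 * nm (x - k) ^+ 2 + 2 * nm (x - k') ^+ 2 -
     4 * nm (x - ((2^-1)%:C%C *: (k - k') + k')) ^+ 2.
    rewrite -!rip_nm !ripE; rewrite (ripC k' k) (ripC k x) (ripC k' x).
    by field.
  move=> -> /= h1 h2 h3.
  have q1 : nm (x - k) ^+ 2 <= (d + s) ^+ 2 by rewrite ler_sqr ?nnegrE//; lra.
  have q2 : nm (x - k') ^+ 2 <= (d + s) ^+ 2 by rewrite ler_sqr ?nnegrE//; lra.
  have q3 : d ^+ 2 <= nm (x - ((2^-1)%:C%C *: (k - k') + k')) ^+ 2.
    by rewrite ler_sqr ?nnegrE//; exact: nm_ge0.
  have q4 : (d + s) ^+ 2 - d ^+ 2 <= (2 * d + 1) * s by nra.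
  have q5 : (2 * d + 1) * s <= (2 * d + 1) * t by rewrite ler_wpM2l//; lra.
  lra.
have Kp : K p.
  apply: Kc => e e0; have [k [[Kk _] hk]] := hp e 1 e0 ltr01.
  by exists k; rewrite nmB.
exists p; split=> // k Kk.
have pd : nm (x - p) <= d.
  apply/ler_addgt0Pr => e e0.
  have e20 : 0 < e / 2 by lra.
  have [k' [[Kk' h1] h2]] := hp _ _ e20 e20.
  by have := nm_triangle x k' p; lra.
have key (t : R) : 0 <= - 2 * t * rip (x - p) k + t ^+ 2 * rip k k.
  have Kt : K (t%:C%C *: k + p) by apply: KL.
  have h1 := dk _ Kt; have h2 := nm_ge0 (x - p).
  have : nm (x - p) ^+ 2 <= nm (x - (t%:C%C *: k + p)) ^+ 2.
    by rewrite ler_sqr ?nnegrE ?nm_ge0//; lra.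
  rewrite -!rip_nm !ripE (ripC k x) (ripC k p) (ripC p x); lra.
have [k0|k0] := pselect (rip k k = 0).
  have := key 1; have := key (-1); rewrite k0; lra.
(* The polynomial in [key] is minimal at [a / b], with value [- (a ^+ 2 / b)]. *)
set a := rip (x - p) k; set b := rip k k; have := key (a / b); rewrite -/a -/b => h.
have b0 : 0 < b by rewrite lt_neqAle rip_ge0 andbT eq_sym; apply/eqP.
have : - 2 * (a / b) * a + (a / b) ^+ 2 * b = - (a ^+ 2 / b).
  by field; rewrite gt_eqF.
move=> e; rewrite e oppr_ge0 in h.
have : a ^+ 2 / b = 0.
  by apply/eqP; rewrite eq_le h divr_ge0// ?sqr_ge0 ?(ltW b0).
by move/eqP; rewrite mulf_eq0 invr_eq0 (gt_eqF b0) orbF sqrf_eq0 => /eqP.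
Qed.

Definition orth K x := forall k, K k -> rip x k = 0.

(** Closedness stands under the existential quantifier so that [proj] takes any predicate without a
    proof argument; the witness 0 in the other case is a dummy. *)
Lemma proj_ex K x : exists p, csub K -> K p /\ orth K (x - p).
Proof.
have [cK|ncK] := pselect (csub K); last by exists 0.
have [p hp] := rproj_exists K x (subsp_rsubsp _ cK.1) cK.2.
by exists p.
Qed.

Definition proj K x : H := projT1 (cid (proj_ex K x)).

Section Proj.
Variables (K : H -> Prop).
Hypothesis cK : csub K.
Let P := proj K.

Lemma projK_in x : K (P x).
Proof. by rewrite /P /proj; case: cid => p /= /(_ cK) []. Qed.

Lemma proj_orth x k : K k -> rip (x - P x) k = 0.
Proof. by move: k; rewrite /P /proj; case: cid => p /= /(_ cK) []. Qed.

Lemma subspD x y : K x -> K y -> K (x + y).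
Proof. by move=> hx hy; have := cK.1.2 1 _ _ hx hy; rewrite scale1r. Qed.

Lemma subspZ (c : R[i]) x : K x -> K (c *: x).
Proof. by move=> hx; have := cK.1.2 c _ _ hx cK.1.1; rewrite addr0. Qed.

Lemma subspB x y : K x -> K y -> K (x - y).
Proof. by move=> hx hy; rewrite -scaleN1r; apply: subspD => //; apply: subspZ. Qed.

Lemma proj_unique x p : K p -> orth K (x - p) -> P x = p.
Proof.
move=> Kp op; apply/subr0_eq/rip_eq0.
have Kd : K (P x - p) by apply: subspB => //; exact: projK_in.
have : rip ((x - p) - (x - P x)) (P x - p) = 0.
  by rewrite ripBl op// proj_orth// subrr.
by rewrite opprB addrC addrA subrK.
Qed.

Lemma proj_id x : K x -> P x = x.
Proof. by move=> Kx; apply: proj_unique => // k _; rewrite subrr rip0l. Qed.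

Lemma proj_idem x : P (P x) = P x.
Proof. exact/proj_id/projK_in. Qed.

Lemma proj_eq0 x : orth K x -> P x = 0.
Proof.
by move=> ox; apply: proj_unique; [exact: cK.1.1|move=> k; rewrite subr0; exact: ox].
Qed.

Lemma proj0_orth x : P x = 0 -> orth K x.
Proof. by move=> h k Kk; have := proj_orth x k Kk; rewrite h subr0. Qed.

Lemma proj_adj x y : rip (P x) y = rip x (P y).
Proof.
have := proj_orth x (P y) (projK_in _).
have := proj_orth y (P x) (projK_in _).
by rewrite !ripBl (ripC y) (ripC (P y)); lra.
Qed.

Lemma proj_rip x : rip (P x) x = rip (P x) (P x).
Proof. by rewrite {1}ripC -proj_adj ?proj_idem// ripC proj_adj proj_idem. Qed.

Lemma proj_nm x : nm (P x) <= nm x.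
Proof.
apply: nm_le_sq; first exact: nm_ge0.
rewrite -rip_nm; have := rip_ge0 (x - P x).
rewrite !ripE -proj_rip (ripC x (P x)); lra.
Qed.

Lemma proj_linear : linear P.
Proof.
move=> c x y; apply: proj_unique.
  by apply: subspD; first apply: subspZ; exact: projK_in.
move=> k Kk; rewrite opprD addrACA -scalerBr ripDl ripZ.
by rewrite !proj_orth ?addr0//; exact: subspZ.
Qed.

End Proj.

Lemma adh_lims D x u : (forall n, D (u n)) -> lims u x -> adh D x.
Proof.
move=> h hu e e0; have [n hn] := hu _ e0; exists (u n); split=> //.
by rewrite nmB; apply: hn.
Qed.

Lemma adh_subsp D : subsp D -> csub (adh D).
Proof.
move=> [D0 DL]; split.
  split; first by move=> e e0; exists 0; rewrite subrr nm0.
  move=> c x y hx hy e e0.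
  have [n0 [n00 hn0]] := small (complex.Re `|c|) (e / 2) (divr_gt0 e0 (ltr0n _ 2)).
  have [x' [Dx' hx']] := hx _ n00; have [y' [Dy' hy']] := hy _ (divr_gt0 e0 (ltr0n _ 2)).
  exists (c *: x' + y'); split; first exact: DL.
  rewrite opprD addrACA -scalerBr; apply: le_lt_trans (nmD _ _) _.
  by rewrite nmZc; have := ler_wpM2l (nmc_ge0 c) (ltW hx'); lra.
move=> x hx e e0; have e20 := divr_gt0 e0 (ltr0n _ 2).
have [y [hy xy]] := hx _ e20; have [z [Dz yz]] := hy _ e20.
by exists z; split=> //; have := nm_triangle x y z; lra.
Qed.

Lemma adh_in D x : D x -> adh D x.
Proof. by move=> Dx e e0; exists x; rewrite subrr nm0. Qed.

Lemma dense_orth D : subsp D -> (forall x, orth D x -> x = 0) -> forall x, adh D x.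
Proof.
move=> sD h x; have cD := adh_subsp D sD.
have : x - proj (adh D) x = 0.
  by apply: h => k Dk; apply: proj_orth => //; exact: adh_in.
by move/subr0_eq => ->; exact: projK_in.
Qed.

End Subspaces.

(** * Bounded operators and adjoints *)

Section OperatorsTheory.
Context {R : realType} {H : hilbertType R}.
Implicit Types (x y z : H) (T S P : H -> H).

Lemma linD T : linear T -> forall x y, T (x + y) = T x + T y.
Proof. by move=> l x y; have := l 1 x y; rewrite !scale1r. Qed.

Lemma lin0 T : linear T -> T 0 = 0.
Proof. by move=> l; apply: (addIr (T 0)); rewrite -linD// !add0r. Qed.

Lemma linZ T : linear T -> forall (c : R[i]) x, T (c *: x) = c *: T x.
Proof. by move=> l c x; have := l c x 0; rewrite (lin0 T)// !addr0. Qed.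

Lemma linN T : linear T -> forall x, T (- x) = - T x.
Proof. by move=> l x; rewrite -scaleN1r linZ// scaleN1r. Qed.

Lemma linB T : linear T -> forall x y, T (x - y) = T x - T y.
Proof. by move=> l x y; rewrite linD// linN. Qed.

Lemma bopP T : bounded_operator T <->
  linear T /\ exists M : R, 0 <= M /\ forall x, nm (T x) <= M * nm x.
Proof.
split=> [[l cT]|[l [M [M0 hM]]]]; split=> //.
  have := cT 0; rewrite /continuous_at lin0// => /cvgrPdist_lt /(_ 1 ltr01).
  move=> /nbhs_ballP [e /= e0 he].
  have eR : e = (complex.Re e)%:C%C by rewrite RRe_real// gtr0_real.
  have d0 : 0 < complex.Re e by rewrite -ltcR -eR.
  set d := complex.Re e in eR d0.
  have hd y : nm y < d -> nm (T y) < 1.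
    move=> yd; have /= := he y; rewrite -ball_normE /= !sub0r !normrN !normE eR.
    by rewrite !ltcR; apply.
  exists (2 / d); split; first by rewrite divr_ge0 ?ltW.
  move=> x; have [->|x0] := pselect (x = 0); first by rewrite lin0// nm0 mulr0.
  have nx : 0 < nm x.
    by rewrite lt_neqAle nm_ge0 andbT eq_sym; apply/eqP => /nm_eq0.
  have a0 : 0 < d / 2 / nm x by rewrite !divr_gt0.
  have := hd ((d / 2 / nm x)%:C%C *: x).
  rewrite linZ// !nmZ !gtr0_norm// divfK ?gt_eqF//.
  have d2 : d / 2 < d by lra.
  move=> /(_ d2); rewrite mulrC -ltr_pdivlMr// => /ltW /le_trans; apply.
  by rewrite le_eqVlt; apply/orP; left; apply/eqP; field; rewrite !gt_eqF.
move=> x; apply/cvgrPdist_lt => e e0.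
have eR : e = (complex.Re e)%:C%C by rewrite RRe_real// gtr0_real.
have d0 : 0 < complex.Re e by rewrite -ltcR -eR.
have [d [dp hd]] := small M (complex.Re e) d0.
apply/nbhs_ballP; exists d%:C%C; first by rewrite /= ltcR.
move=> y; rewrite -ball_normE /= -linB// !normE eR !ltcR => h.
apply: le_lt_trans (hM _) _; apply: le_lt_trans hd.
by rewrite ler_wpM2l// ltW.
Qed.

Definition radj T S := forall x y, rip (T x) y = rip x (S y).

Lemma is_adjointP T S : linear T -> linear S ->
  is_adjoint T S <-> radj T S.
Proof.
move=> lT lS; split=> h x y; first by rewrite /rip h.
by apply: rip_inner => c; rewrite -linZ// h.
Qed.

Lemma adj_sym T S : radj T S -> radj S T.
Proof. by move=> h x y; rewrite ripC -h ripC. Qed.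

Lemma adj_contraction T S : radj T S -> (forall x, nm (T x) <= nm x) ->
  forall x, nm (S x) <= nm x.
Proof.
move=> aTS cT x; have [h0|h0] := leP (nm (S x)) 0; first exact: le_trans h0 (nm_ge0 _).
rewrite -(ler_pM2r h0) -expr2 -rip_nm (adj_sym _ _ aTS).
apply: le_trans (rip_CS _ _) _.
by rewrite ler_wpM2l// nm_ge0.
Qed.

(** Unless [f] is zero, its kernel is closed of real codimension one, so a vector [z] orthogonal to
    it represents [f] after scaling by [f z / <z, z>]. *)
Lemma riesz (f : H -> R) (M : R) :
  (forall (r : R) x y, f (r%:C%C *: x + y) = r * f x + f y) ->
  (forall x, `|f x| <= M * nm x) -> exists v, forall x, f x = rip x v.
Proof.
move=> fL fb.
have f0 : f 0 = 0.
  by have := fb 0; rewrite nm0 mulr0 normr_le0 => /eqP.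
have fZ r x : f (r%:C%C *: x) = r * f x by rewrite -[_ *: _]addr0 fL f0 addr0.
have fB x y : f (x - y) = f x - f y.
  by have := fL (-1) y x; rewrite rmorphN1 scaleN1r addrC mulN1r => ->; rewrite addrC.
have [h|h] := pselect (forall x, f x = 0).
  by exists 0 => x; rewrite rip0r.
have {h}[x0 hx0] : exists x, f x <> 0.
  apply: contrapT => h'; apply: h => x; apply: contrapT => h''.
  by apply: h'; exists x.
have [||p [fp op]] := rproj_exists (fun x => f x = 0) x0.
- by split=> // r x y; rewrite fL => -> ->; rewrite mulr0 addr0.
- move=> x hx; apply/eqP/negPn/negP; rewrite -normr_gt0 => fx.
  have [d [d0 hd]] := small M _ fx.
  have [y [fy xy]] := hx _ d0; have := fb (x - y); rewrite fB fy subr0.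
  have M0 : 0 <= M.
    have := fb x0; have := nm_ge0 x0; rewrite leNgt.
    have : 0 < `|f x0| by rewrite normr_gt0; apply/eqP.
    by nra.
  by have := ler_wpM2l M0 (ltW xy); lra.
have fz : f (x0 - p) = f x0 by rewrite fB fp subr0.
move: (x0 - p) op fz => z op fz.
have zz : rip z z <> 0.
  by move/rip_eq0 => z0; apply: hx0; rewrite -fz z0.
exists ((f z / rip z z)%:C%C *: z) => x.
have : f (x - (f x / f z)%:C%C *: z) = 0.
  by rewrite fB fZ divfK ?subrr//; apply/eqP; rewrite fz.
move/op; rewrite !ripE (ripC z x) => h.
have -> : rip x z = f x / f z * rip z z by lra.
by field; apply/andP; split; apply/eqP => //; rewrite fz.
Qed.

Lemma adj_exists T : bounded_operator T ->
  exists S, bounded_operator S /\ is_adjoint T S.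
Proof.
move=> /bopP[l [M [M0 hM]]].
have hv y : exists v, forall x, rip (T x) y = rip x v.
  apply: (riesz _ (M * nm y)) => [r x z|x].
    by rewrite linD// linZ// !ripE.
  have h z : rip (T z) y <= M * nm y * nm z.
    apply: le_trans (rip_CS _ _) _.
    by have := ler_wpM2r (nm_ge0 y) (hM z); lra.
  rewrite ler_norml h andbT.
  by have := h (- x); rewrite linN// ripNl nmN; lra.
have [S hS] := choice hv.
have lS : linear S.
  move=> c x y; apply: rip_inj => z; rewrite (ripC _ z) -hS ripDr ripDl ripZ.
  rewrite (ripC (T z) (c *: x)) ripZ -linZ// (ripC (S x)) -hS (ripC (S y)) -hS.
  by rewrite (ripC x).
exists S; split; last exact/is_adjointP.
apply/bopP; split=> //; exists M; split=> // y.
have [h|h] := leP (nm (S y)) 0.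
  by apply: le_trans h _; rewrite mulr_ge0// nm_ge0.
rewrite -(ler_pM2l h) -expr2 -rip_nm -hS.
apply: le_trans (rip_CS _ _) _.
by have := ler_wpM2r (nm_ge0 y) (hM (S y)); lra.
Qed.

Lemma proj_bop (K : H -> Prop) : csub K -> bounded_operator (proj K).
Proof.
move=> cK; apply/bopP; split; first exact: proj_linear.
by exists 1; split=> // x; rewrite mul1r proj_nm.
Qed.

Lemma projectionP (P : H -> H) : projection P <->
  [/\ bounded_operator P, forall x, P (P x) = P x & radj P P].
Proof.
split=> [[b i a]|[b i a]]; split=> //.
- by move=> x; have /= := congr1 (@^~ x) i.
- by have [l _] := b; apply: (is_adjointP P P l l).1.
- exact/funext.
- by have [l _] := b; apply: (is_adjointP P P l l).2.
Qed.

Lemma proj_projection (K : H -> Prop) : csub K -> projection (proj K).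
Proof.
move=> cK; apply/projectionP; split; first exact: proj_bop.
  exact: proj_idem.
exact: proj_adj.
Qed.

Lemma projection_nm P x : projection P -> nm (P x) <= nm x.
Proof.
move=> /projectionP[/bopP[l _] i a].
apply: nm_le_sq; first exact: nm_ge0.
rewrite -rip_nm; have := rip_ge0 (x - P x).
have : rip (P x) (P x) = rip x (P x) by rewrite a i.
by rewrite !ripE (ripC (P x) x); lra.
Qed.

Lemma bop_comp T S : bounded_operator T -> bounded_operator S ->
  bounded_operator (T \o S).
Proof.
move=> /bopP[lT [M [M0 hM]]] /bopP[lS [N [N0 hN]]]; apply/bopP; split.
  by move=> c x y /=; rewrite lS lT.
exists (M * N); split=> [|x /=]; first exact: mulr_ge0.
by apply: le_trans (hM _) _; rewrite -mulrA ler_wpM2l.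
Qed.

Lemma ker_csub T : bounded_operator T -> csub (fun x => T x = 0).
Proof.
move=> /bopP[l [M [M0 hM]]]; split.
  split=> [|c x y hx hy]; first exact: lin0.
  by rewrite l hx hy scaler0 addr0.
move=> x hx; apply: nm_eq0; apply/eqP; rewrite eq_le nm_ge0 andbT.
apply/ler_addgt0Pr => e e0; rewrite add0r.
have [d [d0 hd]] := small M e e0; have [y [Ty xy]] := hx _ d0.
rewrite -[T x]subr0 -Ty -linB//; apply: le_trans (hM _) _.
by apply/ltW; apply: le_lt_trans hd; rewrite ler_wpM2l// ltW.
Qed.

Lemma lims_bop T (u : nat -> H) x : bounded_operator T -> lims u x ->
  lims (fun n => T (u n)) (T x).
Proof.
move=> /bopP[l [M [M0 hM]]] hu; apply: (lims_le u _ x _ M) => // n.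
by rewrite -linB.
Qed.

End OperatorsTheory.

(** * Projections in a von Neumann algebra *)

Section VonNeumannAlgebra.
Context {R : realType} {H : hilbertType R} (A : set (H -> H)).
Hypothesis hA : von_neumann_algebra A.
Implicit Types (x y z : H) (S T Z : H -> H) (K : H -> Prop).

Lemma vna_bop T : A T -> bounded_operator T.
Proof. by case: hA => [[h _ _ _ _] _]; apply: h. Qed.

Lemma vna_lin T : A T -> linear T.
Proof. by case/vna_bop. Qed.

Lemma vnaD S T : A S -> A T -> A (fun x => S x + T x).
Proof. by case: hA => [[_ h _ _ _] _]; apply: h. Qed.

Lemma vnaZ (c : R[i]) T : A T -> A (fun x => c *: T x).
Proof. by case: hA => [[_ _ h _ _] _]; apply: h. Qed.

Lemma vna_comp S T : A S -> A T -> A (fun x => S (T x)).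
Proof. by case: hA => [[_ _ _ h _] _]; apply: h. Qed.

Lemma vna_adj T : A T -> exists S, A S /\ radj T S.
Proof.
move=> AT; case: (hA) => [[_ _ _ _ h] _]; have [S [AS TS]] := h _ AT.
by exists S; split=> //; apply: (is_adjointP _ _ (vna_lin _ AT) (vna_lin _ AS)).1.
Qed.

Lemma commE S T x : commutant A S -> A T -> S (T x) = T (S x).
Proof. by move=> [_ h] /h/(congr1 (@^~ x)). Qed.

Lemma comm_bop S : commutant A S -> bounded_operator S.
Proof. by case. Qed.

(** Operators obtained by limits or closures (projections, partial isometries, square roots) enter
    [A] through the double commutant in this form. *)
Lemma vna_dc T : bounded_operator T ->
  (forall S, commutant A S -> forall x, T (S x) = S (T x)) -> A T.
Proof.
move=> bT h; case: (hA) => _ <-; split=> // S cS; apply/funext => x /=.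
exact: h.
Qed.

Lemma vna_id : A (fun x => x).
Proof.
apply: vna_dc => //; apply/bopP; split=> //.
by exists 1; split=> // x; rewrite mul1r.
Qed.

Lemma vnaB S T : A S -> A T -> A (fun x => S x - T x).
Proof.
move=> AS AT; have := vnaD _ _ AS (vnaZ (-1) _ AT).
by congr (A _); apply/funext => x; rewrite scaleN1r.
Qed.

Lemma comm_adj S : commutant A S ->
  exists S', commutant A S' /\ radj S S'.
Proof.
move=> cS; have bS := comm_bop _ cS; have [S' [bS' SS']] := adj_exists _ bS.
have h := (is_adjointP _ _ bS.1 bS'.1).1 SS'.
exists S'; split=> //; split=> // T AT; apply/funext => x /=.
have [T' [AT' TT']] := vna_adj _ AT.
apply: rip_inj => z.
by rewrite (adj_sym _ _ h) TT' -commE// -(adj_sym _ _ h) -TT'.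
Qed.

Lemma proj_comm K S S' : csub K -> bounded_operator S -> radj S S' ->
  (forall x, K x -> K (S x)) -> (forall x, K x -> K (S' x)) ->
  forall x, proj K (S x) = S (proj K x).
Proof.
move=> cK [lS _] SS' KS KS' x; apply: proj_unique => //.
  by apply: KS; exact: projK_in.
by move=> k Kk; rewrite -linB// SS' proj_orth//; exact: KS'.
Qed.

(** For a closed subspace, [cinv] puts the projection into [A] and [ainv] puts it into the commutant
    of [A]; the two together make it central. *)
Definition cinv K := forall S, commutant A S -> forall x, K x -> K (S x).
Definition ainv K := forall S, A S -> forall x, K x -> K (S x).

Lemma vna_proj K : csub K -> cinv K -> A (proj K).
Proof.
move=> cK iK; apply: vna_dc; first exact: proj_bop.
move=> S cS x; have [S' [cS' SS']] := comm_adj _ cS.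
by apply: (proj_comm _ _ S' _ (comm_bop _ cS) SS') => // y; apply: iK.
Qed.

Lemma center_proj K : csub K -> cinv K -> ainv K ->
  vn_center A (proj K) /\ projection (proj K).
Proof.
move=> cK iK aK; split; last exact: proj_projection.
split; first exact: vna_proj.
split; first exact: proj_bop.
move=> S AS; apply/funext => x /=; have [S' [AS' SS']] := vna_adj _ AS.
by apply: (proj_comm _ _ S' _ (vna_bop _ AS) SS') => // y; apply: aK.
Qed.

Lemma centerE Z T x : vn_center A Z -> A T -> Z (T x) = T (Z x).
Proof. by case=> _ cZ AT; rewrite (commE _ _ _ cZ AT). Qed.

Lemma cinv_ker T : A T -> cinv (fun x => T x = 0).
Proof.
by move=> AT S cS x hx; rewrite -(commE _ _ _ cS AT) hx lin0//; case: cS => -[].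
Qed.

Lemma vna_proj_ker T : A T -> A (proj (fun x => T x = 0)).
Proof.
by move=> AT; apply: vna_proj; [apply/ker_csub/vna_bop|exact: cinv_ker].
Qed.

Lemma cinv_adh K : cinv K -> cinv (adh K).
Proof.
move=> iK S cS x /lims_adh[u [Ku hu]].
apply: (adh_lims _ _ (fun n => S (u n))); first by move=> n; apply: iK.
exact: (lims_bop _ _ _ (comm_bop _ cS) hu).
Qed.

End VonNeumannAlgebra.

(** * Partial isometries from isometric graphs *)

Section Graphs.
Context {R : realType} {H : hilbertType R}.
Implicit Types (x y z : H) (G : H -> H -> Prop).

(** An isometric linear relation is single-valued in both directions. The notion is therefore
    symmetric under [gtr], and the transposed graph yields the adjoint partial isometry. *)
Definition giso G :=
  [/\ G 0 0, forall c x y x' y', G x y -> G x' y' -> G (c *: x + x') (c *: y + y')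
    & forall x y, G x y -> rip x x = rip y y].

Definition gdom G x := exists y, G x y.

Definition gtr G x y := G y x.

Definition gcl G x y :=
  exists u v, [/\ forall n : nat, G (u n) (v n), lims u x & lims v y].

Lemma giso_tr G : giso G -> giso (gtr G).
Proof.
by move=> [h0 hL hi]; split=> // [c x y x' y'|x y /hi->//]; exact: hL.
Qed.

Lemma giso_rip G x y x' y' : giso G -> G x y -> G x' y' -> rip x x' = rip y y'.
Proof.
move=> [h0 hL hi] g g'; have := hi _ _ (hL 1 _ _ _ _ g g').
rewrite !scale1r !ripE (hi _ _ g) (hi _ _ g') (ripC x' x) (ripC y' y); lra.
Qed.

Lemma gdom_subsp G : giso G -> subsp (gdom G).
Proof.
move=> [h0 hL hi]; split; first by exists 0.
by move=> c x y [x' hx] [y' hy]; exists (c *: x' + y'); apply: hL.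
Qed.

Lemma gisoB G x y x' y' : giso G -> G x y -> G x' y' -> G (x - x') (y - y').
Proof.
move=> [h0 hL hi] g g'; have := hL (-1) _ _ _ _ g' g.
by rewrite !scaleN1r addrC [- y' + _]addrC.
Qed.

Lemma giso_nm G x y : giso G -> G x y -> nm x = nm y.
Proof.
move=> [_ _ hi] /hi; rewrite !rip_nm => /eqP.
by rewrite eqrXn2 ?nm_ge0// => /eqP.
Qed.

Lemma lims_lin (c : R[i]) u v x y : lims u x -> lims v y ->
  lims (fun n => c *: u n + v n) (c *: x + y).
Proof.
move=> hu hv e e0; have e20 := divr_gt0 e0 (ltr0n _ 2).
have [d [d0 hd]] := small (complex.Re `|c|) _ e20.
have [n hn] := hu _ d0; have [m hm] := hv _ e20.
exists (maxn n m) => p; rewrite geq_max => /andP[/hn h1 /hm h2].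
rewrite opprD addrACA -scalerBr; apply: le_lt_trans (nmD _ _) _.
by rewrite nmZc; have := ler_wpM2l (nmc_ge0 c) (ltW h1); lra.
Qed.

Lemma lims_nm_le (u v : nat -> H) x y : lims u x -> lims v y ->
  (forall n, nm (u n) <= nm (v n)) -> nm x <= nm y.
Proof.
move=> hu hv h; apply/ler_addgt0Pr => e e0; have e20 := divr_gt0 e0 (ltr0n _ 2).
have [n hn] := hu _ e20; have [m hm] := hv _ e20.
have := hn _ (leq_maxl n m); have := hm _ (leq_maxr n m); have := h (maxn n m).
have := nm_split x (u (maxn n m)); have := nm_split (v (maxn n m)) y.
by rewrite (nmB x); lra.
Qed.

Lemma lims_cst x : lims (fun=> x) x.
Proof. by move=> e e0; exists 0%N => p _; rewrite subrr nm0. Qed.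

Lemma gcl_in G x y : G x y -> gcl G x y.
Proof. by move=> g; exists (fun=> x), (fun=> y); split=> //; exact: lims_cst. Qed.

Lemma giso_cl G : giso G -> giso (gcl G).
Proof.
move=> gG; have [h0 hL hi] := gG; split; first exact: gcl_in.
  move=> c x y x' y' [u [v [g hu hv]]] [u' [v' [g' hu' hv']]].
  exists (fun n => c *: u n + u' n), (fun n => c *: v n + v' n).
  by split=> [n||]; [exact: hL|exact: lims_lin|exact: lims_lin].
move=> x y [u [v [g hu hv]]]; rewrite !rip_nm; congr (_ ^+ 2).
have e n := giso_nm _ _ _ gG (g n).
by apply/eqP; rewrite eq_le; apply/andP; split;
  [apply: (lims_nm_le _ _ _ _ hu hv)|apply: (lims_nm_le _ _ _ _ hv hu)] => n; rewrite e.
Qed.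

Lemma gcl_dom G x : giso G -> adh (gdom G) x -> exists y, gcl G x y.
Proof.
move=> gG /lims_adh[u [/choice[v g] hu]].
have [|y hv] := @lims_cauchy _ _ v; last by exists y, u, v.
move=> e e0; have e20 := divr_gt0 e0 (ltr0n _ 2); have [n hn] := hu _ e20.
exists n => p q /hn h1 /hn h2.
rewrite -(giso_nm _ _ _ gG (gisoB _ _ _ _ _ gG (g p) (g q))).
by have := nm_triangle (u p) x (u q); rewrite (nmB x); lra.
Qed.

Lemma gcl_dom_adh G x y : gcl G x y -> adh (gdom G) x.
Proof.
by move=> [u [v [g hu hv]]]; apply: adh_lims hu => n; exists (v n).
Qed.

Lemma gcl_tr G x y : gcl G x y -> gcl (gtr G) y x.
Proof. by move=> [u [v [g hu hv]]]; exists v, u. Qed.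

Lemma giso_unique G x y y' : giso G -> G x y -> G x y' -> y = y'.
Proof.
move=> gG g g'; apply/subr0_eq/nm_eq0.
by rewrite -(giso_nm _ _ _ gG (gisoB _ _ _ _ _ gG g g')) subrr nm0.
Qed.

Lemma gext_ex G x : exists y, giso G -> gcl G (proj (adh (gdom G)) x) y.
Proof.
have [gG|ng] := pselect (giso G); last by exists 0.
have [|y hy] := gcl_dom G (proj (adh (gdom G)) x) gG; last by exists y.
by apply: projK_in; apply: adh_subsp; exact: gdom_subsp.
Qed.

(* The partial isometry whose graph over [adh (gdom G)] is the closure of [G],
   extended by 0 to the orthogonal complement. *)
Definition gext G x : H := projT1 (cid (gext_ex G x)).

Lemma gextP G x : giso G -> gcl G (proj (adh (gdom G)) x) (gext G x).
Proof. by move=> gG; rewrite /gext; case: cid => y /= /(_ gG). Qed.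

Section Extension.
Variable G : H -> H -> Prop.
Hypothesis gG : giso G.
Let D := adh (gdom G).
Let cD : csub D := adh_subsp _ (gdom_subsp _ gG).
Let gC := giso_cl _ gG.

Lemma gext_graph x y : gcl G x y -> gext G x = y.
Proof.
move=> g; apply: (giso_unique _ x _ _ gC) => //.
have := gextP G x gG; rewrite proj_id//; exact: gcl_dom_adh g.
Qed.

Lemma gext_lin : linear (gext G).
Proof.
move=> c x y; apply: (giso_unique _ _ _ _ gC (gextP _ _ gG)).
by rewrite (proj_linear _ cD); case: gC => _ h _; apply: h; exact: gextP.
Qed.

Lemma gext_bop : bounded_operator (gext G).
Proof.
apply/bopP; split; first exact: gext_lin.
exists 1; split=> // x; rewrite mul1r -(giso_nm _ _ _ gC (gextP _ x gG)).
exact: proj_nm.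
Qed.

End Extension.

Lemma gext_tr G x : giso G -> gext (gtr G) (gext G x) = proj (adh (gdom G)) x.
Proof.
move=> gG; apply: gext_graph; first exact: giso_tr.
exact/gcl_tr/gextP.
Qed.

(** Projecting [y] on the closed range and [x] on the closed domain changes neither side; what
    remains is that the closed graph preserves inner products. *)
Lemma gext_adj G : giso G -> radj (gext G) (gext (gtr G)).
Proof.
move=> gG x y; have gT := giso_tr _ gG.
have cD := adh_subsp _ (gdom_subsp _ gG); have cR := adh_subsp _ (gdom_subsp _ gT).
have g1 := gextP _ x gG; have /gcl_tr g2 := gextP _ y gT.
have {}g2 : gcl G (gext (gtr G) y) (proj (adh (gdom (gtr G))) y) by [].
have e := giso_rip _ _ _ _ _ (giso_cl _ gG) g1 g2.
have <- : proj (adh (gdom (gtr G))) (gext G x) = gext G x.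
  by apply: proj_id => //; apply: gcl_dom_adh; exact: gcl_tr g1.
rewrite proj_adj// -e proj_adj// proj_id//; exact: gcl_dom_adh g2.
Qed.

(** An [S] in the commutant preserves the closed graph and commutes with the projection on the
    closed domain, which lies in [A]; uniqueness of values then gives commutation with [gext G]. *)
Lemma gext_vna (A : set (H -> H)) G : von_neumann_algebra A -> giso G ->
  (forall S, commutant A S -> forall x y, G x y -> G (S x) (S y)) -> A (gext G).
Proof.
move=> hA gG iG; have cD := adh_subsp _ (gdom_subsp _ gG).
apply: vna_dc => //; first exact: gext_bop.
have iD : cinv A (gdom G) by move=> S cS x [y g]; exists (S y); exact: iG.
move=> S cS x.
apply: (giso_unique _ _ _ _ (giso_cl _ gG) (gextP _ _ gG)).
have -> : proj (adh (gdom G)) (S x) = S (proj (adh (gdom G)) x).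
  by rewrite (commE _ _ _ _ cS)//; apply: vna_proj => //; exact: cinv_adh.
have [u [v [g hu hv]]] := gextP _ x gG; have bS := comm_bop _ _ cS.
exists (fun n => S (u n)), (fun n => S (v n)); split=> [n||].
- exact: iG.
- exact: lims_bop.
- exact: lims_bop.
Qed.

End Graphs.

(** * Square roots and absolute values *)

Section SquareRoot.
Context {R : realType} {H : hilbertType R}.
Implicit Types (x y z : H).

(* [1 - (1 - b)^(1/2)] is the limit of the iteration [Y' = (b + Y^2) / 2] from 0.
   The increments of [Y] are dominated by those of the same iteration at the
   scalar [b = 1], which is increasing and bounded. *)
Fixpoint sqrt_rate n : R := if n is m.+1 then (1 + sqrt_rate m ^+ 2) / 2 else 0.

Lemma sqrt_rate01 n : 0 <= sqrt_rate n <= 1.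
Proof. by elim: n => [|n IH] /=; [rewrite lexx ler01|nra]. Qed.

Lemma sqrt_rateS n : sqrt_rate n <= sqrt_rate n.+1.
Proof. by have := sqrt_rate01 n; rewrite /=; nra. Qed.

Section Iteration.
Variable b : H -> H.
Hypothesis bl : linear b.
Hypothesis bs : radj b b.
Hypothesis bn : forall x, nm (b x) <= nm x.

Fixpoint sqrt_iter n x : H :=
  if n is m.+1 then (2^-1)%:C%C *: (b x + sqrt_iter m (sqrt_iter m x)) else 0.
Notation Y := sqrt_iter.
Notation r := sqrt_rate.

Lemma sqrt_iter_lin n : linear (Y n).
Proof.
elim: n => [|n IH] c x y /=; first by rewrite scaler0 addr0.
by rewrite bl !IH addrACA -scalerDr (scalerDr _ (c *: _)) !scalerA mulrC.
Qed.

Lemma sqrt_iter_comm B n x : linear B -> (forall x, B (b x) = b (B x)) ->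
  B (Y n x) = Y n (B x).
Proof.
move=> lB h; elim: n x => [|n IH] x /=; first by rewrite lin0.
by rewrite linZ// linD// h !IH.
Qed.

Lemma sqrt_iter_adj n : radj (Y n) (Y n).
Proof.
elim: n => [|n IH] x y /=; first by rewrite rip0l rip0r.
by rewrite !ripE bs !IH.
Qed.

Lemma sqrt_iterC n m x : Y n (Y m x) = Y m (Y n x).
Proof.
apply: sqrt_iter_comm; first exact: sqrt_iter_lin.
by move=> y; rewrite sqrt_iter_comm.
Qed.

Lemma sqrt_iter_nm n x : nm (Y n x) <= r n * nm x.
Proof.
elim: n x => [|n IH] x /=; first by rewrite nm0 mul0r.
rewrite nmZ ger0_norm ?invr_ge0//.
have := nmD (b x) (Y n (Y n x)); have := bn x; have := IH (Y n x); have := IH x.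
have := sqrt_rate01 n; have := nm_ge0 x; nra.
Qed.

Lemma sqrt_iter_step n x : nm (Y n.+1 x - Y n x) <= (r n.+1 - r n) * nm x.
Proof.
elim: n x => [|n IH] x.
  by rewrite /= subr0 addr0 nmZ ger0_norm ?invr_ge0//; have := bn x; lra.
(* The iterates commute, so [Y'^2 - Y^2] factors as [(Y' - Y) (Y' + Y)]; the scalar sequence factors
   in the same way, which carries the bound through the induction. *)
have -> : Y n.+2 x - Y n.+1 x =
   (2^-1)%:C%C *: (Y n.+1 (Y n.+1 x + Y n x) - Y n (Y n.+1 x + Y n x)).
  have yS k : Y k.+1 x = (2^-1)%:C%C *: (b x + Y k (Y k x)) by [].
  rewrite yS [X in _ - X]yS -scalerBr; congr (_ *: _).
  rewrite !(linD _ (sqrt_iter_lin _)) (sqrt_iterC n n.+1).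
  by rewrite [b x + Y n.+1 _]addrC !addrKA.
rewrite nmZ ger0_norm ?invr_ge0//.
have := IH (Y n.+1 x + Y n x); have := nmD (Y n.+1 x) (Y n x).
have := sqrt_iter_nm n x; have := sqrt_iter_nm n.+1 x.
have -> : r n.+2 = (1 + r n.+1 ^+ 2) / 2 by [].
have e : r n.+1 = (1 + r n ^+ 2) / 2 by [].
have := sqrt_rateS n; have := sqrt_rate01 n; have := nm_ge0 x.
move: (r n.+1) e (nm x) (Y n.+1 _) (Y n _) => s e X u v X0 r0 rs h1 h2 h3 h4.
have h5 : (s - r n) * nm (u + v) <= (s - r n) * ((s + r n) * X).
  by apply: ler_wpM2l; lra.
by rewrite [X in _ <= (_ - X) * _]e; nra.
Qed.

Lemma sqrt_iter_dist n m x : (n <= m)%N -> nm (Y m x - Y n x) <= (r m - r n) * nm x.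
Proof.
move=> /subnK <-; elim: (m - n)%N => [|k IH]; first by rewrite !subrr nm0 mul0r.
have := nm_triangle (Y (k + n).+1 x) (Y (k + n) x) (Y n x).
by have := sqrt_iter_step (k + n) x; rewrite addSn; lra.
Qed.

Let s := sup [set r n | n in setT]%classic.
Let hs : has_sup [set r n | n in setT]%classic.
Proof.
split; first by exists (r 0), 0%N.
by exists 1 => _ [n _ <-]; have /andP[] := sqrt_rate01 n.
Qed.

Let rs n : r n <= s.
Proof. by apply: ub_le_sup; [exact: hs.2|exists n]. Qed.

Let rs_lim e : 0 < e -> exists n, forall m, (n <= m)%N -> s - r m < e.
Proof.
move=> e0; have [_ [n _ <-] hn] := sup_adherent e0 hs.
exists n => m nm; suff : r n <= r m by rewrite -/s in hn; lra.
move: nm => /subnK <-; elim: (m - n)%N => // k IH.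
exact: le_trans IH (sqrt_rateS _).
Qed.

Let Ylim_ex x : exists y, lims (fun n => Y n x) y.
Proof.
apply: lims_cauchy => e e0; have [d [d0 hd]] := small (nm x) e e0.
have [n hn] := rs_lim _ d0; exists n.
have key p q : (n <= p)%N -> (p <= q)%N -> nm (Y q x - Y p x) < e.
  move=> np pq; apply: le_lt_trans (sqrt_iter_dist _ _ _ pq) _.
  apply: le_lt_trans hd; rewrite mulrC ler_wpM2l ?nm_ge0//.
  by have := hn p np; have := rs q; lra.
move=> p q np nq; have [pq|/ltnW qp] := leqP p q; last exact: key.
by rewrite nmB; exact: key.
Qed.

Let L x := projT1 (cid (Ylim_ex x)).
Let LP x : lims (fun n => Y n x) (L x).
Proof. by rewrite /L; case: cid. Qed.

Let Ll : linear L.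
Proof.
move=> c x y; apply: (lims_unique _ _ _ (LP _)).
have -> : (fun n => Y n (c *: x + y)) = fun n => c *: Y n x + Y n y.
  by apply/funext => n; rewrite sqrt_iter_lin.
exact: lims_lin.
Qed.

Let Ln x : nm (L x) <= nm x.
Proof.
apply: (lims_nm _ _ _ (LP x)) => n; apply: le_trans (sqrt_iter_nm _ _) _.
by have := sqrt_rate01 n; have := nm_ge0 x; nra.
Qed.

Let L2 x : L x = (2^-1)%:C%C *: (b x + L (L x)).
Proof.
have hS : lims (fun n => Y n.+1 x) (L x).
  by move=> e /(LP x)[n hn]; exists n => p np; apply: hn; exact: leqW.
apply: (lims_unique _ _ _ hS) => e e0.
have e20 := divr_gt0 e0 (ltr0n _ 2).
have [n hn] := LP x _ e20; have [m hm] := LP (L x) _ e20.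
exists (maxn n m) => p; rewrite geq_max => /andP[/hn h1 /hm h2] /=.
rewrite -scalerBr nmZ ger0_norm ?invr_ge0// opprD addrACA subrr add0r.
have := nm_triangle (Y p (Y p x)) (Y p (L x)) (L (L x)).
rewrite -(linB _ (sqrt_iter_lin p)); have := sqrt_iter_nm p (Y p x - L x).
have := sqrt_rate01 p; have := nm_ge0 (Y p x - L x); nra.
Qed.

Let Lcomm B x : bounded_operator B -> (forall x, B (b x) = b (B x)) ->
  B (L x) = L (B x).
Proof.
move=> bB h; apply: (lims_unique _ _ _ (lims_bop _ _ _ bB (LP x))).
rewrite (_ : (fun n => _) = fun n => Y n (B x)); first exact: LP.
by apply/funext => n; rewrite sqrt_iter_comm//; case: bB.
Qed.

Let Ls : radj L L.
Proof.
have key x y : rip (L x) y <= rip x (L y).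
  by apply: (lims_rip_le _ _ _ _ _ _ (LP x) (LP y)) => n; rewrite sqrt_iter_adj.
move=> x y; apply/eqP; rewrite eq_le key /=.
by have := key y x; rewrite (ripC _ x) (ripC y).
Qed.

(** The fixed point equation [L = (b + L^2) / 2] amounts to [(1 - L)^2 = 1 - b]. The commutation
    clause is what later places the root in [A] and makes it commute with the operator under the
    absolute value. *)
Lemma sqrt_exists : exists S : H -> H,
  [/\ bounded_operator S, radj S S, forall x, 0 <= rip (S x) x,
      forall x, S (S x) = x - b x
    & forall B x, bounded_operator B -> (forall x, B (b x) = b (B x)) ->
        B (S x) = S (B x)].
Proof.
exists (fun x => x - L x); split.
- apply/bopP; split; last first.
    by exists 2; split=> // x; have := nmD x (- L x); rewrite nmN; have := Ln x; lra.
  by move=> c x y; rewrite Ll opprD addrACA -scalerBr.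
- by move=> x y; rewrite !ripE Ls.
- move=> x; rewrite ripBl rip_nm; have := rip_CS (L x) x.
  by have := ler_wpM2r (nm_ge0 x) (Ln x); lra.
- move=> x; rewrite (linB _ Ll) opprB.
  have := L2 x => /(congr1 (fun v => 2%:C%C *: v)).
  rewrite scalerA -rmorphM divff ?pnatr_eq0// rmorph1 scale1r.
  rewrite (_ : 2%:C%C *: L x = L x + L x); last first.
    by rewrite rmorphD rmorph1 scalerDl scale1r.
  move/eqP; rewrite -subr_eq => /eqP <-.
  by rewrite opprB opprD -addrA [L (L x) + (_ - _)]addrCA.
- move=> B x bB h; by rewrite (linB B bB.1) Lcomm.
Qed.

End Iteration.

(* [S] is the absolute value of [X]: take the square root of [X^* X] after scaling
   [X] to a contraction. *)
Lemma abs_exists X X' : bounded_operator X -> bounded_operator X' -> radj X X' ->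
  exists S : H -> H,
  [/\ bounded_operator S, radj S S, forall x, 0 <= rip (S x) x,
      forall x, S (S x) = X' (X x)
    & forall B x, bounded_operator B -> (forall x, B (X' (X x)) = X' (X (B x))) ->
        B (S x) = S (B x)].
Proof.
move=> bX bX' XX'; have X'X := adj_sym _ _ XX'.
have [lX [M [M0 hM]]] := (bopP _).1 bX; have [lX' _] := bX'.
(* Adding 1 keeps the scaling factor invertible when [M = 0]. *)
pose m := (M + 1)^-1; have M1 : M + 1 != 0 by rewrite gt_eqF// ltr_wpDl.
have m0 : 0 < m by rewrite invr_gt0 ltr_wpDl.
pose b x := x - (m ^+ 2)%:C%C *: X' (X x).
have hX x : nm (X x) ^+ 2 * m ^+ 2 <= nm x ^+ 2.
  have h : nm (X x) * m <= nm x.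
    by rewrite /m ler_pdivrMr ?ltr_wpDl//; have := hM x; have := nm_ge0 x; nra.
  have h0 : 0 <= nm (X x) * m by rewrite mulr_ge0 ?nm_ge0 ?(ltW m0).
  by rewrite -exprMn ler_sqr ?nnegrE ?nm_ge0.
have hX' x : nm (X' x) ^+ 2 * m ^+ 2 <= nm x ^+ 2.
  have [h|h] := leP (nm (X' x)) 0.
    by have -> : nm (X' x) = 0; [have := nm_ge0 (X' x); lra|rewrite expr0n mul0r sqr_ge0].
  have : (nm (X' x) ^+ 2) ^+ 2 * m ^+ 2 <= (nm (X' x) * nm x) ^+ 2.
    rewrite -[nm (X' x) ^+ 2]rip_nm X'X.
    have := rip_CS x (X (X' x)); have := hX (X' x).
    rewrite -X'X rip_nm => h1 h2.
    have h3 : (nm (X' x) ^+ 2) ^+ 2 <= (nm x * nm (X (X' x))) ^+ 2.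
      by rewrite ler_sqr ?nnegrE ?mulr_ge0 ?sqr_ge0 ?nm_ge0.
    have := sqr_ge0 (nm x); have := sqr_ge0 m; rewrite !exprMn in h3 *; nra.
  move=> q; rewrite -(ler_pM2l (exprn_gt0 2 h)); apply: le_trans (le_trans q _).
    by rewrite le_eqVlt; apply/orP; left; apply/eqP; ring.
  by rewrite exprMn.
have bl : linear b.
  move=> c x y; rewrite /b lX lX' scalerDr opprD addrACA scalerA mulrC -scalerA.
  by rewrite -scalerBr.
have bs : radj b b.
  by move=> x y; rewrite /b !ripE X'X XX'.
(* [|b x|^2 = |x|^2 - 2 m^2 |X x|^2 + m^4 |X' X x|^2], and the last term is at most
   [m^2 |X x|^2]. *)
have bn x : nm (b x) <= nm x.
  apply: nm_le_sq; first exact: nm_ge0.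
  rewrite /b !ripE X'X (ripC x) X'X !rip_nm.
  by have := hX' (X x); have := sqr_ge0 m; nra.
have [S0 [bS0 S0s S0p S0S0 S0c]] := sqrt_exists b bl bs bn.
have [lS0 [N [N0 hN]]] := (bopP _).1 bS0.
exists (fun x => (M + 1)%:C%C *: S0 x); split.
- apply/bopP; split; last first.
    exists ((M + 1) * N); split; first by rewrite mulr_ge0// addr_ge0.
    move=> x; rewrite nmZ ger0_norm ?addr_ge0// -mulrA ler_wpM2l// addr_ge0//.
  by move=> c x y; rewrite lS0 scalerDr !scalerA mulrC.
- by move=> x y; rewrite !ripE S0s.
- by move=> x; rewrite ripE mulr_ge0// addr_ge0.
- move=> x; rewrite linZ// S0S0 /b subKr !scalerA -!rmorphM /=.
  by rewrite (_ : _ * _ * _ = 1) ?scale1r// /m; field.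
- move=> B x bB h; have lB := bB.1; rewrite linZ// S0c// => y.
  by rewrite /b linB// linZ// h.
Qed.

End SquareRoot.

Lemma abs_vna {R : realType} {H : hilbertType R} (A : set (H -> H)) X X' :
  von_neumann_algebra A -> A X -> A X' -> radj X X' ->
  exists S : H -> H,
  [/\ A S, radj S S, forall x, 0 <= rip (S x) x,
      forall x, S (S x) = X' (X x)
    & forall B x, bounded_operator B -> (forall x, B (X' (X x)) = X' (X (B x))) ->
        B (S x) = S (B x)].
Proof.
move=> hA AX AX' XX'.
have [S [bS Ss Sp SS Sc]] := abs_exists X X' (vna_bop _ hA _ AX) (vna_bop _ hA _ AX') XX'.
exists S; split=> //; apply: vna_dc => // B cB x.
rewrite (Sc B x (comm_bop _ _ cB))// => y.
by rewrite (commE _ _ _ _ cB AX') (commE _ _ _ _ cB AX).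
Qed.

(** * Comparison with an abelian projection *)

Section Comparison.
Context {R : realType} {H : hilbertType R} (A : set (H -> H)).
Hypothesis hA : von_neumann_algebra A.
Implicit Types (x y z : H) (S T V W P Q E F : H -> H).

Lemma projE P : projection P -> forall x, P (P x) = P x.
Proof. by case/projectionP. Qed.

Lemma projA P : projection P -> radj P P.
Proof. by case/projectionP. Qed.

Lemma projL P : projection P -> linear P.
Proof. by case=> -[]. Qed.

Lemma proj_bounded P : projection P -> bounded_operator P.
Proof. by case. Qed.

Lemma adh_fix P (K : H -> Prop) : bounded_operator P ->
  (forall x, K x -> P x = x) -> forall x, adh K x -> P x = x.
Proof.
move=> bP h x /lims_adh[u [Ku hu]].
apply: (lims_unique _ _ _ (lims_bop _ _ _ bP hu)).
by rewrite (_ : (fun n => _) = u)//; apply/funext => n; exact: h.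
Qed.

Lemma proj_swap E F : projection E -> projection F ->
  (forall x, F (E x) = E x) -> forall x, E (F x) = E x.
Proof.
move=> pE pF h x; apply: rip_inj => z.
by rewrite (projA _ pE) (projA _ pF) h (projA _ pE).
Qed.

Lemma projection_sub E F : projection E -> projection F ->
  (forall x, F (E x) = E x) -> projection (fun x => F x - E x).
Proof.
move=> pE pF h; have h' := proj_swap _ _ pE pF h.
have [lE lF] := (projL _ pE, projL _ pF); apply/projectionP; split.
- apply/bopP; split; first by move=> c x y; rewrite lE lF opprD addrACA -scalerBr.
  exists 2; split=> // x; have := nmD (F x) (- E x); rewrite nmN.
  by have := projection_nm _ x pE; have := projection_nm _ x pF; lra.
- by move=> x; rewrite (linB _ lF) (linB _ lE) !projE// h h' subrr subr0.
- by move=> x y; rewrite !ripE (projA _ pE) (projA _ pF).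
Qed.

(* Murray-von Neumann subequivalence of [F] and [P]. *)
Definition embeds F P V W :=
  [/\ A V, A W, radj V W, forall x, W (V x) = F x & forall x, P (V x) = V x].

Lemma embeds_r F P V W x : projection F -> embeds F P V W -> V (F x) = V x.
Proof.
move=> pF [AV AW VW WV PV]; apply/esym/subr0_eq/rip_eq0.
have lV := vna_lin _ hA _ AV; have lF := projL _ pF.
by rewrite -(linB _ lV) VW WV (linB _ lF) projE// subrr rip0r.
Qed.

Lemma embeds_l F P V W x : projection F -> embeds F P V W -> F (W x) = W x.
Proof.
move=> pF e; have [AV AW VW WV PV] := e; apply: rip_inj => z.
by rewrite (projA _ pF) !(adj_sym _ _ VW) (embeds_r _ _ _ _ _ pF e).
Qed.

Lemma embeds_W F P V W x : projection P -> embeds F P V W -> W (P x) = W x.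
Proof.
move=> pP [AV AW VW WV PV]; apply: rip_inj => z.
by rewrite !(adj_sym _ _ VW) (projA _ pP) PV.
Qed.

Definition abelian F := forall S T, A S -> A T ->
  forall x, F (S (F (T (F x)))) = F (T (F (S (F x)))).

(* Adding the point 0 makes the union of the empty chain admissible. *)
Definition graph_of (X : set (H * H)) x y := X (x, y) \/ (x = 0 /\ y = 0).

Definition admissible F P (X : set (H * H)) :=
  [/\ giso (graph_of X),
      forall S, commutant A S -> forall x y, X (x, y) -> X (S x, S y)
    & forall x y, X (x, y) -> F x = x /\ P y = y].

Lemma admissible_chain F P (C : set (set (H * H))) :
  (forall X, C X -> admissible F P X) -> total_on C subset ->
  admissible F P (\bigcup_(X in C) X)%classic.
Proof.
move=> hC tC; split.
- have g0 (X : set (H * H)) : graph_of X 0 0 by right.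
  have sub X x y : C X -> graph_of X x y -> graph_of (\bigcup_(X in C) X)%classic x y.
    by move=> CX [h|]; [left; exists X|right].
  have key x y x' y' : graph_of (\bigcup_(X in C) X)%classic x y ->
      graph_of (\bigcup_(X in C) X)%classic x' y' ->
      (x = 0 /\ y = 0) /\ (x' = 0 /\ y' = 0) \/
      exists X, [/\ C X, graph_of X x y & graph_of X x' y'].
    move=> [[X CX Xx]|z] [[X' CX' Xx']|z'].
    - right; have [XX'|X'X] := tC _ _ CX CX'.
        by exists X'; split=> //; left => //; exact: XX'.
      by exists X; split=> //; left => //; exact: X'X.
    - by right; exists X; split=> //; [left|right].
    - by right; exists X'; split=> //; [right|left].
    - by left.
  split=> [||x y]; first exact: g0.
    move=> c x y x' y' h h'; have [[[-> ->] [-> ->]]|[X [CX g g']]] := key _ _ _ _ h h'.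
      by rewrite !scaler0 !addr0; exact: g0.
    by apply: (sub X) => //; have [[_ hL _] _ _] := hC _ CX; exact: hL.
  move=> [[X CX Xx]|[-> ->]]//; have [[_ _ hi] _ _] := hC _ CX.
  by apply: hi; left.
- move=> S cS x y [X CX Xx]; exists X => //.
  by have [_ hX _] := hC _ CX; exact: hX.
- by move=> x y [X CX Xx]; have [_ _ hX] := hC _ CX; exact: hX.
Qed.

(* Take a maximal isometric graph from [F H] to [P H]; let [F'] and [Q] be its
   initial and final projections and [E = F - F']. For [T] in [A], [Q T E = 0]
   because [F A F] is commutative and [E F' = 0], and [(P - Q) T E = 0] because the
   partial isometry of its polar decomposition would extend the graph. *)
Lemma comparison F P : A F -> projection F -> abelian F -> A P -> projection P ->
  (exists V W, embeds F P V W) \/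
  exists E, [/\ A E, projection E, exists x, E x <> 0, forall x, F (E x) = E x
    & forall T, A T -> forall x, P (T (E x)) = 0].
Proof.
move=> AF pF abF AP pP.
have [X [[gG iX rX] Xmax]] := Zorn_bigcup (fun C hC tC => admissible_chain F P C hC tC).
set G := graph_of X in gG.
have iG S : commutant A S -> forall x y, G x y -> G (S x) (S y).
  move=> cS x y [h|[-> ->]]; first by left; exact: iX.
  by right; rewrite (lin0 S)//; case: (comm_bop _ _ cS).
have gT := giso_tr _ gG.
have iT S : commutant A S -> forall x y, gtr G x y -> gtr G (S x) (S y).
  by move=> cS x y; exact: iG.
have cD := adh_subsp _ (gdom_subsp _ gG); have cR := adh_subsp _ (gdom_subsp _ gT).
pose V := gext G; pose W := gext (gtr G).
pose F' := proj (adh (gdom G)); pose Q := proj (adh (gdom (gtr G))).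
have AV : A V by exact: gext_vna.
have AW : A W by exact: gext_vna.
have WV x : W (V x) = F' x by exact: gext_tr.
have VW x : V (W x) = Q x by exact: (gext_tr (gtr G)).
have aVW : radj V W by exact: gext_adj.
have pF' : projection F' by exact: proj_projection.
have pQ : projection Q by exact: proj_projection.
have lF := projL _ pF; have lP := projL _ pP.
have lF' := projL _ pF'; have lQ := projL _ pQ.
have FF' x : F (F' x) = F' x.
  apply: (adh_fix _ _ (proj_bounded _ pF) _ _ (projK_in _ cD x)) => {}x [y [/rX[]//|[-> _]]].
  exact: (lin0 _ lF).
have PQ x : P (Q x) = Q x.
  apply: (adh_fix _ _ (proj_bounded _ pP) _ _ (projK_in _ cR x)) => {}x [y [/rX[]//|[_ ->]]].
  exact: (lin0 _ lP).
have F'F := proj_swap _ _ pF' pF FF'; have QP := proj_swap _ _ pQ pP PQ.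
have AF' : A F' by rewrite (_ : F' = fun x => W (V x)); [exact: vna_comp|apply/funext].
have AQ : A Q by rewrite (_ : Q = fun x => V (W x)); [exact: vna_comp|apply/funext].
have F'W x : F' (W x) = W x.
  by apply: proj_id => //; exact: gcl_dom_adh (gcl_tr _ _ _ (gextP _ x gT)).
have QV x : Q (V x) = V x.
  by apply: proj_id => //; exact: gcl_dom_adh (gcl_tr _ _ _ (gextP _ x gG)).
pose E x := F x - F' x.
have [E0|E0] := pselect (forall x, E x = 0).
  left; exists V, W; split=> // x; first by rewrite WV; apply/esym/subr0_eq/E0.
  by rewrite -QV PQ.
right; exists E; have pE : projection E by exact: projection_sub.
have FE x : F (E x) = E x by rewrite /E (linB _ lF) projE// FF'.
have F'E x : F' (E x) = 0 by rewrite /E (linB _ lF') F'F projE// subrr.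
have AE : A E by exact: vnaB.
split=> //.
  by apply: contrapT => h; apply: E0 => x; apply: contrapT => h'; apply: h; exists x.
move=> T AT.
(* As [Q = V W] and [W = F' W], it suffices that [F' W T E = 0]. In the commutative corner [F']
   moves past [W T] and meets [E], where it vanishes. *)
have QTE x : Q (T (E x)) = 0.
  have lV := vna_lin _ hA _ AV.
  have h := abF F' (fun y => W (T y)) AF' (vna_comp _ hA _ _ AW AT) (E x).
  have {}h : F' (F (W (T (F (E x))))) = 0.
    rewrite -FF' h FE F'E.
    have lWT := vna_lin _ hA _ (vna_comp _ hA _ _ AW AT).
    by rewrite (lin0 _ lF) (lin0 _ lWT) (lin0 _ lF).
  by rewrite -VW -F'W -F'F -[E x]FE h (lin0 _ lV).
pose Y x := P (T (E x)) - Q (T (E x)).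
have YE x : Y x = P (T (E x)) by rewrite /Y QTE subr0.
have AY : A Y.
  have ATE := vna_comp _ hA _ _ AT AE.
  exact: (vnaB _ hA _ _ (vna_comp _ hA _ _ AP ATE) (vna_comp _ hA _ _ AQ ATE)).
have [Y' [AY' YY']] := vna_adj _ hA _ AY.
have lY := vna_lin _ hA _ AY.
have lY' := vna_lin _ hA _ AY'.
have [S [AS Ss Sp SS _]] := abs_vna _ _ _ hA AY AY' YY'.
have lS := vna_lin _ hA _ AS.
have QY x : Q (Y x) = 0 by rewrite YE QP QTE.
have PY x : P (Y x) = Y x by rewrite YE projE.
(* So the pairs [(S x, Y x)] form an isometric graph, that of the partial isometry in the polar
   decomposition of [Y]. *)
have SY x y : rip (S x) (S y) = rip (Y x) (Y y).
  by rewrite Ss SS [RHS]YY'.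
have S0 x : Y x = 0 -> S x = 0 by move=> h; apply: rip_eq0; rewrite SY h rip0l.
(* [Y], and with it [S], vanishes on the range of [1 - F]; since [S] is self-adjoint, its range lies
   in that of [F]. *)
have FS x : F (S x) = S x.
  apply: rip_inj => z; rewrite (projA _ pF) Ss [RHS]Ss; congr rip.
  apply/subr0_eq; rewrite -(linB _ lS); apply: S0; rewrite YE (_ : E _ = 0).
    by rewrite (lin0 _ (vna_lin _ hA _ AT)) (lin0 _ lP).
  by rewrite /E (linB _ lF) (linB _ lF') projE// F'F !subrr.
have Sdom x x' y' : G x' y' -> rip (S x) x' = 0.
  move=> g; rewrite Ss (S0 x') ?rip0r// YE (_ : E x' = 0).
    by rewrite (lin0 _ (vna_lin _ hA _ AT)) (lin0 _ lP).
  have dx : gdom G x' by exists y'.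
  have -> : x' = F' x' by rewrite /F' proj_id//; exact: adh_in.
  by rewrite /E FF' projE// subrr.
have Yran x x' y' : G x' y' -> rip (Y x) y' = 0.
  move=> g; have dy : gdom (gtr G) y' by exists x'.
  have -> : y' = Q y' by rewrite /Q proj_id//; exact: adh_in.
  by rewrite -(projA _ pQ) QY rip0l.
clearbody Y.
(* The sum of the two graphs is again isometric, because [S] maps into the orthogonal complement of
   the domain of [G] and [Y] into that of its range. *)
pose X2 : set (H * H) := [set p | exists x x' y',
  [/\ G x' y', p.1 = S x + x' & p.2 = Y x + y']]%classic.
have G0 : G 0 0 by right.
have X2X : (X2 `<=` X)%classic.
  apply: contrapT => nX; apply: (Xmax X2); first split=> //.
    by move=> [x y] Xx; exists 0, x, y; rewrite (lin0 _ lS) (lin0 _ lY) !add0r;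
       split=> //; left.
  have GX2 x y : graph_of X2 x y -> X2 (x, y).
    by move=> [//|[-> ->]]; exists 0, 0, 0; rewrite (lin0 _ lS) (lin0 _ lY) !add0r.
  split.
  - split; first by right.
      move=> c x y x' y' /GX2[u [v [w [/= g -> ->]]]] /GX2[u' [v' [w' [/= g' -> ->]]]].
      left; exists (c *: u + u'), (c *: v + v'), (c *: w + w').
      split=> /=; first by case: gG => _ h _; exact: h.
        by rewrite lS scalerDr addrACA.
      by rewrite lY scalerDr addrACA.
    move=> x y /GX2[u [v [w [/= g -> ->]]]].
    rewrite !ripE (ripC v) (ripC w) (Sdom _ _ _ g) (Yran _ _ _ g) SY.
    by rewrite (giso_rip _ _ _ _ _ gG g g).
  - move=> B cB x y [u [v [w [/= g -> ->]]]].
    have lB := (comm_bop _ _ cB).1.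
    exists (B u), (B v), (B w); split=> /=; first exact: iG.
      by rewrite (linD _ lB) (commE _ _ _ _ cB).
    by rewrite (linD _ lB) (commE _ _ _ _ cB).
  - move=> x y [u [v [w [/= g -> ->]]]]; rewrite (linD _ lF) (linD _ lP) FS PY.
    by case: g => [/rX[-> ->]//|[-> ->]]; rewrite (lin0 _ lF) (lin0 _ lP).
move=> x; rewrite -YE.
(* By maximality [Y x] lies in the range of [G], to which it is also orthogonal. *)
have g : G (S x) (Y x).
  by left; apply: X2X; exists x, 0, 0; rewrite !addr0.
have := Yran x _ _ g; exact: rip_eq0.
Qed.

End Comparison.

(** * Finite multiplicity *)

Section FiniteExhaustion.
Context {R : realType} {H : hilbertType R} (A : set (H -> H)).
Hypothesis hA : von_neumann_algebra A.
Implicit Types (x y z : H) (S T V W E F : H -> H).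

Lemma finite_isometry V W : finite_algebra A -> A V -> A W -> radj V W ->
  (forall x, W (V x) = x) -> forall x, V (W x) = x.
Proof.
move=> hfin AV AW aVW WV x.
have lV := vna_lin _ hA _ AV; have lW := vna_lin _ hA _ AW.
have AE := vna_comp _ hA _ _ AV AW.
suff /(congr1 (@^~ x)) : (fun x => V (W x)) = idfun by [].
apply: hfin => //.
  apply/projectionP; split; first exact: (vna_bop _ hA _ AE).
    by move=> y; rewrite WV.
  by move=> y z; rewrite aVW (adj_sym _ _ aVW).
exists V, W; split=> //; first exact/is_adjointP.
by apply/funext => y /=; rewrite WV.
Qed.

(** [U i] carries [F] onto a copy [U i (W i x)] inside the rest [P i], and [P i.+1] is what remains
    once this copy is removed. *)
Variables (F : H -> H) (P U W : nat -> H -> H).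
Hypothesis pF : projection F.
Hypothesis P0 : forall x, P 0%N x = x.
Hypothesis PS : forall n x, P n.+1 x = P n x - U n (W n x).

Lemma exhaustion_rest n :
  (forall i, (i < n)%N -> embeds A F (P i) (U i) (W i)) ->
  [/\ A (P n), projection (P n) & forall x, x - P n x = \sum_(i < n) U i (W i x)].
Proof.
elim: n => [|n IH] h.
  have -> : P 0 = id by apply/funext => x; rewrite P0.
  split=> [||x]; first exact: (vna_id _ hA).
    by apply/projectionP; split=> //; exact: (vna_bop _ hA _ (vna_id _ hA)).
  by rewrite big_ord0 subrr.
have [|AP pP eP] := IH; first by move=> i /leqW; exact: h.
have e := h _ (leqnn n.+1); have [AU AW aUW WU PU] := e.
have -> : P n.+1 = fun x => P n x - U n (W n x) by apply/funext => x; rewrite PS.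
split.
- exact: (vnaB _ hA _ _ AP (vna_comp _ hA _ _ AU AW)).
- apply: projection_sub => //; apply/projectionP; split.
  + exact: (vna_bop _ hA _ (vna_comp _ hA _ _ AU AW)).
  + by move=> x; rewrite WU (embeds_l _ hA _ _ _ _ _ pF e).
  + by move=> x y; rewrite aUW (adj_sym _ _ aUW).
- by move=> x; rewrite big_ord_recr /= -eP opprB addrA addrAC.
Qed.

Section Shift.
Hypothesis h : forall n, embeds A F (P n) (U n) (W n).

Let AP n : A (P n). Proof. by case: (exhaustion_rest n (fun i _ => h i)). Qed.
Let pP n : projection (P n).
Proof. by case: (exhaustion_rest n (fun i _ => h i)). Qed.
Let AU n : A (U n). Proof. by case: (h n). Qed.
Let AW n : A (W n). Proof. by case: (h n). Qed.
Let aUW n : radj (U n) (W n). Proof. by case: (h n). Qed.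
Let WU n x : W n (U n x) = F x. Proof. by case: (h n). Qed.
Let PU n x : P n (U n x) = U n x. Proof. by case: (h n). Qed.
Let lP n := projL _ (pP n).
Let lU n := vna_lin _ hA _ (AU n).
Let lW n := vna_lin _ hA _ (AW n).
Let WP n x : W n (P n x) = W n x.
Proof. exact: (embeds_W _ _ _ _ _ _ (pP n) (h n)). Qed.
Let UF n x : U n (F x) = U n x.
Proof. exact: (embeds_r _ hA _ _ _ _ _ pF (h n)). Qed.
Let FW n x : F (W n x) = W n x.
Proof. exact: (embeds_l _ hA _ _ _ _ _ pF (h n)). Qed.

Let PSU n x : P n.+1 (U n x) = 0.
Proof. by rewrite PS PU WU UF subrr. Qed.

Let PPS n x : P n (P n.+1 x) = P n.+1 x.
Proof. by rewrite !PS (linB _ (lP n)) projE// PU. Qed.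

Let PSP n x : P n.+1 (P n x) = P n.+1 x.
Proof. exact: (proj_swap _ _ (pP _) (pP _) (PPS n) x). Qed.

Let Ple n m x : (n <= m)%N -> P m (P n x) = P m x.
Proof.
move=> /subnK <-; elim: (m - n)%N => [|k IH]; first by rewrite projE.
by rewrite addSn -PSP IH PSP.
Qed.

Let PU0 n m x : (n < m)%N -> P m (U n x) = 0.
Proof. by move=> nm; rewrite -(Ple _ _ _ nm) PSU (lin0 _ (lP m)). Qed.

Let WU0 n m x : (n < m)%N -> W m (U n x) = 0.
Proof. by move=> nm; rewrite -WP PU0// (lin0 _ (lW m)). Qed.

Let WUr n m x : (n < m)%N -> W n (U m x) = 0.
Proof.
move=> nm; apply: rip_inj => z.
by rewrite (adj_sym _ _ (aUW n)) aUW WU0// rip0r rip0l.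
Qed.

Let WP0 n m x : (n < m)%N -> W n (P m x) = 0.
Proof.
move=> nm; apply: rip_inj => z.
by rewrite (adj_sym _ _ (aUW n)) (projA _ (pP m)) PU0// rip0r rip0l.
Qed.

(** Partial sums of the shift: copy [i] goes to copy [i + 1] for all [i < n]. *)
Fixpoint shift n x : H :=
  if n is m.+1 then shift m x + U m.+1 (W m x) else 0.

Let shift_vna n : A (shift n).
Proof.
elim: n => [|n IH].
  rewrite (_ : shift 0 = fun x => (0 : R[i]) *: x); first exact: (vnaZ _ hA _ _ (vna_id _ hA)).
  by apply/funext => x; rewrite scale0r.
exact: (vnaD _ hA _ _ IH (vna_comp _ hA _ _ (AU _) (AW _))).
Qed.

Let shift_rest n m x : (n < m)%N -> P m (shift n x) = 0.
Proof.
elim: n => [|n IH] nm /=; first by rewrite (lin0 _ (lP m)).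
by rewrite (linD _ (lP m)) IH ?PU0 ?addr0// ltnW.
Qed.

(** From [n] to [n + 1] the rest loses [U n (W n x)] and the shift gains the orthogonal term
    [U n.+1 (W n x)] of the same norm. *)
Let shift_norm n x :
  rip (shift n x) (shift n x) + rip (P n x) (P n x) = rip x x.
Proof.
elim: n => [|n IH]; first by rewrite P0 rip0l add0r.
rewrite -IH /= !ripDl !ripDr.
have c : rip (shift n x) (U n.+1 (W n x)) = 0.
  by rewrite -PU -(projA _ (pP _)) shift_rest// rip0l.
rewrite (ripC (U _ _) (shift n x)) c.
have -> : rip (U n.+1 (W n x)) (U n.+1 (W n x)) = rip x (U n (W n x)).
  by rewrite aUW WU FW (adj_sym _ _ (aUW n)).
rewrite (projA _ (pP n.+1)) projE// (projA _ (pP n)) (projE (P n))// PS ripBr.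
by ring.
Qed.

(** Restricting to vectors that meet finitely many copies makes the shift a finite sum; their
    component outside all copies is then [P n x] and stays fixed. The condition [0 < n] makes [W 0]
    vanish on [P n x]. *)
Let G x y := exists n, [/\ (0 < n)%N, forall k, (n <= k)%N -> W k x = 0
  & y = shift n x + P n x].

Let Gup n m x : (forall k, (n <= k)%N -> W k x = 0) -> (n <= m)%N ->
  shift n x + P n x = shift m x + P m x.
Proof.
move=> Wx /subnK <-; elim: (m - n)%N => [|k IH]//.
rewrite addSn /= PS Wx ?leq_addl// (lin0 _ (lU _)) (lin0 _ (lU _)).
by rewrite addr0 subr0.
Qed.

Let giso_shift : giso G.
Proof.
split.
- exists 1%N; split=> // [k _|]; first by rewrite (lin0 _ (lW k)).
  by rewrite (lin0 _ (vna_lin _ hA _ (shift_vna _))) (lin0 _ (lP _)) addr0.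
- move=> c x y x' y' [n [n0 Wx ->]] [m [m0 Wx' ->]].
  exists (maxn n m); split; first by rewrite leq_max n0.
    move=> k; rewrite geq_max => /andP[nk mk].
    by rewrite lW Wx// Wx'// scaler0 addr0.
  rewrite (Gup _ _ _ Wx (leq_maxl n m)) (Gup _ _ _ Wx' (leq_maxr n m)).
  have l := vna_lin _ hA _ (shift_vna (maxn n m)).
  by rewrite l lP scalerDr addrACA.
- move=> x y [n [_ Wx ->]]; rewrite !ripDl !ripDr.
  have e : P n x = P n.+1 x by rewrite PS Wx// (lin0 _ (lU _)) subr0.
  have c : rip (shift n x) (P n x) = 0.
    by rewrite e -(projA _ (pP _)) shift_rest// rip0l.
  by rewrite (ripC (P n x) (shift n x)) c -(shift_norm n x); ring.
Qed.

(* The shift [U n y |-> U n.+1 y] is a non-unitary isometry. *)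
Lemma shift_contradiction : finite_algebra A -> forall x, F x = 0.
Proof.
move=> hfin x.
have gG := giso_shift; have gT := giso_tr _ gG.
have iG S : commutant A S -> forall x y, G x y -> G (S x) (S y).
  move=> cS {}x y [n [n0 Wx ->]]; have lS := (comm_bop _ _ cS).1.
  exists n; split=> // [k nk|]; first by rewrite -(commE _ _ _ _ cS)// Wx// (lin0 _ lS).
  by rewrite (linD _ lS) (commE _ _ _ _ cS (shift_vna n)) (commE _ _ _ _ cS (AP n)).
(* A vector orthogonal to the domain is orthogonal to every copy, hence lies in the domain
   itself. *)
have dense : forall x, adh (gdom G) x.
  apply: dense_orth; first exact: gdom_subsp.
  move=> z oz.
  have Wz n : W n z = 0.
    apply: rip_inj => u; rewrite (adj_sym _ _ (aUW n)) rip0l; apply: oz.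
    exists (shift n.+1 (U n u) + P n.+1 (U n u)), n.+1; split=> // k nk.
    exact: WU0.
  by apply: rip_eq0; apply: oz; exists (shift 1 z + P 1 z), 1%N; split.
have W0 y : adh (gdom (gtr G)) y -> W 0 y = 0.
  move=> /lims_adh[u [gu hu]].
  apply: (lims_unique _ _ _ (lims_bop _ _ _ (vna_bop _ hA _ (AW 0)) hu)).
  rewrite (_ : (fun n => _) = fun=> 0); first exact: lims_cst.
  apply/funext => n; have [z [m [m0 Wz ->]]] := gu n.
  rewrite (linD _ (lW 0)) WP0// addr0.
  elim: (m) => [|k IH] /=; first by rewrite (lin0 _ (lW 0)).
  by rewrite (linD _ (lW 0)) IH WUr// addr0.
(* Finiteness makes the isometry surjective, so [U 0 x] lies in its range, where [W 0] vanishes; but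
   [W 0 (U 0 x) = F x]. *)
rewrite -(WU 0) -[U 0 x](finite_isometry (gext G) (gext (gtr G)) hfin).
- apply: W0; exact: (gcl_dom_adh _ _ _ (gcl_tr _ _ _ (gextP _ _ gG))).
- exact: gext_vna.
- by apply: gext_vna => // S cS y z; exact: iG.
- exact: gext_adj.
- move=> y; rewrite gext_tr// proj_id//; apply: adh_subsp; exact: gdom_subsp.
Qed.

End Shift.
End FiniteExhaustion.

Section Exhaust.
Context {R : realType} {H : hilbertType R} (A : set (H -> H)).
Hypothesis hA : von_neumann_algebra A.
Hypothesis hfin : finite_algebra A.

(** Copies of [F] are split off while [F] still embeds in the rest. If this never stopped, the shift
    would contradict finiteness, so there is a least [n] at which it stops. *)
Lemma finite_multiplicity (F : H -> H) : A F -> projection F -> (exists x, F x <> 0) ->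
  exists n (P : H -> H) (U W : nat -> H -> H),
  [/\ A P, projection P,
      forall i, (i < n)%N ->
        [/\ A (U i), A (W i), radj (U i) (W i) & forall x, F (W i x) = W i x],
      forall x, x - P x = \sum_(i < n) U i (W i x)
    & ~ exists V W, embeds A F P V W].
Proof.
move=> AF pF [x0 Fx0].
(* The default [(id, id)] is not reached at the indices used below, since [F] embeds in the rest
   there. *)
pose step (P : H -> H) : (H -> H) * (H -> H) :=
  if pselect (exists vw : (H -> H) * (H -> H), embeds A F P vw.1 vw.2) is left h
  then projT1 (cid h) else (id, id).
have stepP P : (exists V W, embeds A F P V W) -> embeds A F P (step P).1 (step P).2.
  move=> [V [W e]]; rewrite /step; case: pselect => [h|[]]; first by case: cid.
  by exists (V, W).
pose P := fix rest n x := if n is m.+1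
  then rest m x - (step (rest m)).1 ((step (rest m)).2 x) else x.
pose U n := (step (P n)).1; pose W n := (step (P n)).2.
have [all|ex] := pselect (forall n, exists V W, embeds A F (P n) V W).
  case: Fx0; apply: (shift_contradiction A hA F P U W) => // n.
  exact: stepP.
have {}ex : exists n, `[< ~ exists V W, embeds A F (P n) V W >].
  apply: contrapT => h; apply: ex => n; apply: contrapT => h'.
  by apply: h; exists n; apply/asboolP.
case: (ex_minnP ex) => n /asboolP hn hmin.
have emb i : (i < n)%N -> embeds A F (P i) (U i) (W i).
  move=> lin; apply: stepP; apply: contrapT => h'.
  by have := hmin i (asboolT h'); rewrite leqNgt lin.
have [AP pP eP] := exhaustion_rest A hA F P U W pF (fun=> erefl) (fun _ _ => erefl) n emb.
exists n, (P n), U, W; split=> // i /emb e; have [] := e; split=> // x.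
exact: (embeds_l _ hA _ _ _ _ _ pF e).
Qed.

End Exhaust.

(** * Spectral cuts *)

Section SpectralCut.
Context {R : realType} {H : hilbertType R} (A : set (H -> H)).
Hypothesis hA : von_neumann_algebra A.
Variable b : H -> H.
Hypothesis Ab : A b.
Hypothesis bs : radj b b.
(** This is [0 <= b <= 1], written as [b^2 <= b]. *)
Hypothesis b2 : forall x, rip (b x) (b x) <= rip (b x) x.
Implicit Types (x y z : H) (E : H -> H).

(** Stands for the spectral projection of [b] on [[0, e]]. The upper bound concerns [|b E x|^2], the
    quantity that the smallness estimate consumes; [b2] derives it from the bound on the quadratic
    form. *)
Definition cut (e : R) E :=
  [/\ projection E, forall x, rip (b (E x)) (b (E x)) <= e * rip (E x) (E x)
    & forall x, E x = 0 -> e * rip x x <= rip (b x) x].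

(* With [X = b - e], [E] projects onto the kernel of [|X| + X]: there [X = -|X|],
   and on the orthogonal complement, which is orthogonal to the range of
   [|X| - X], [X = |X|]. *)
Lemma cut_exists (e : R) : exists E, A E /\ cut e E.
Proof.
have lb := vna_lin _ hA _ Ab.
pose X x := b x - e%:C%C *: x.
have AX : A X by exact: (vnaB _ hA _ _ Ab (vnaZ _ hA _ _ (vna_id _ hA))).
have Xs : radj X X by move=> x y; rewrite /X !ripE bs.
have lX := vna_lin _ hA _ AX.
have [S [AS Ss Sp SS Sc]] := abs_vna _ _ _ hA AX AX Xs.
have XS x : X (S x) = S (X x) by apply: Sc => //; exact: (vna_bop _ hA _ AX).
have lS := vna_lin _ hA _ AS.
have Ap : A (fun x => S x + X x) by exact: vnaD.
have ck := ker_csub _ (vna_bop _ hA _ Ap).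
exists (proj (fun x => S x + X x = 0)); split; first exact: (vna_proj_ker _ hA _ Ap).
have XE x : rip (X x) x = rip (b x) x - e * rip x x by rewrite /X !ripE.
split; first exact: proj_projection.
  move=> x; apply: le_trans (b2 _) _.
  have h := projK_in _ ck x; move: (proj _ x) h => {}x h.
  have : rip (X x) x = - rip (S x) x.
    by rewrite -ripNl; congr rip; apply/eqP; rewrite -addr_eq0 addrC h.
  by rewrite XE; have := Sp x; lra.
move=> x /(proj0_orth _ ck) ox.
(* [(S + X) (S - X) = S^2 - X^2 = 0] puts the range of [S - X] in the kernel. *)
have e1 : S x = X x.
  apply: rip_inj => z; rewrite Ss Xs; apply/eqP; rewrite -subr_eq0 -ripBr.
  apply/eqP/ox.
  by rewrite (linB _ lS) (linB _ lX) SS XS addrA subrK subrr.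
by have := Sp x; rewrite e1 XE; lra.
Qed.

Hypothesis b0 : forall x, b x = 0 -> x = 0.

(** An injective self-adjoint [b] has dense range, and on the range [|E b y|^2 = <y, b E b y> <=
    sqrt e |y| |E b y|], so [|E b y| <= sqrt e |y|]. *)
Lemma cut_small_vec x (t : R) : 0 < t ->
  exists e0, 0 < e0 /\ forall e E, e <= e0 -> cut e E -> rip (E x) (E x) < t.
Proof.
move=> t0; have lb := vna_lin _ hA _ Ab.
have dense : forall x, adh (fun y => exists z, y = b z) x.
  apply: dense_orth.
    split; first by exists 0; rewrite (lin0 _ lb).
    by move=> c y y' [z ->] [z' ->]; exists (c *: z + z'); rewrite lb.
  move=> z oz; apply: b0; apply: rip_eq0; rewrite bs; apply: oz; by exists (b z).
(* Two errors below [d] are to be added and squared, and [(2 d)^2 = min(1, t)^2 <= t]. *)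
pose d := Num.min 1 t / 2.
have d0 : 0 < d by rewrite divr_gt0// lt_min ltr01.
have dt : (2 * d) ^+ 2 <= t.
  have m0 : 0 < Num.min 1 t by rewrite lt_min ltr01.
  have m1 : Num.min 1 t <= 1 by rewrite ge_min lexx.
  have mt : Num.min 1 t <= t by rewrite ge_min lexx orbT.
  by have -> : 2 * d = Num.min 1 t; [rewrite /d; field|nra].
have [_ [[y ->] hy]] := dense x _ d0.
have [e0 [e00 he]] := small (nm y ^+ 2) (d ^+ 2) (exprn_gt0 2 d0).
exists e0; split=> // e E ee [pE hE _].
apply: lt_le_trans dt; rewrite rip_nm ltr_sqr ?nnegrE ?nm_ge0//; last first.
  by rewrite mulr_ge0// ltW.
have hEb : nm (E (b y)) < d.
  rewrite -ltr_sqr ?nnegrE ?nm_ge0// ?(ltW d0)//; apply: le_lt_trans he.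
  set p := nm (E (b y)).
  have h1 : p ^+ 2 <= nm y * nm (b (E (b y))).
    by rewrite /p -rip_nm (projA _ pE) projE// bs; exact: rip_CS.
  have h2 : nm (b (E (b y))) ^+ 2 <= e * p ^+ 2 by rewrite /p -!rip_nm.
  have p0 : 0 <= p := nm_ge0 _.
  have [->|p1] := eqVneq p 0; first by rewrite expr0n mulr_ge0 ?sqr_ge0// ltW.
  have p2 : 0 < p ^+ 2 by rewrite exprn_gt0// lt_neqAle eq_sym p1.
  have y0 : 0 <= nm y := nm_ge0 _.
  have h3 : (p ^+ 2) ^+ 2 <= nm y ^+ 2 * nm (b (E (b y))) ^+ 2.
    have q0 : 0 <= nm y * nm (b (E (b y))) by rewrite mulr_ge0// nm_ge0.
    by rewrite -exprMn ler_sqr ?nnegrE// (ltW p2).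
  rewrite -(ler_pM2r p2).
  have h4 := ler_wpM2l (sqr_ge0 (nm y)) h2.
  have h5 := ler_wpM2r (ltW p2) (ler_wpM2l (sqr_ge0 (nm y)) ee).
  by rewrite expr2 in h3; lra.
have := nmD (E (x - b y)) (E (b y)); rewrite -(linD _ (projL _ pE)) subrK.
by have := projection_nm _ (x - b y) pE; lra.
Qed.

Lemma cut_small n (u : nat -> H) (t : R) : 0 < t ->
  exists e0, 0 < e0 /\ forall e E, e <= e0 -> cut e E ->
    \sum_(i < n) rip (E (u i)) (E (u i)) < t.
Proof.
elim: n t => [|n IH] t t0; first by exists 1; split=> // e E _ _; rewrite big_ord0.
have t20 := divr_gt0 t0 (ltr0n _ 2).
have [e1 [e10 h1]] := IH _ t20; have [e2 [e20 h2]] := cut_small_vec (u n) _ t20.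
exists (Num.min e1 e2); split; first by rewrite lt_min e10.
move=> e E; rewrite le_min => /andP[ee1 ee2] cE; rewrite big_ord_recr /=.
by have := h1 _ _ ee1 cE; have := h2 _ _ ee2 cE; lra.
Qed.

End SpectralCut.

(** * A central projection with a spectral gap *)

Section CentralGap.
Context {R : realType} {H : hilbertType R} (A : set (H -> H)).
Hypothesis hA : von_neumann_algebra A.
Implicit Types (x y z : H) (E F Z Q : H -> H).

Lemma fun_neq0 (F : H -> H) : F <> 0 -> exists x, F x <> 0.
Proof.
move=> h; apply: contrapT => h'; apply: h; apply/funext => x.
by apply: contrapT => h''; apply: h'; exists x.
Qed.

Lemma abelian_projectionP F : abelian_projection A F -> abelian A F.
Proof.
move=> [AF pF h] S T AS AT x; have /(congr1 (@^~ x)) /= := h _ _ AS AT.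
by rewrite !projE.
Qed.

Lemma abelian_sub F E : A E -> projection E -> projection F ->
  (forall x, F (E x) = E x) -> abelian A F -> abelian A E.
Proof.
move=> AE pE pF FE abF S T AS AT x; have EF := proj_swap _ _ pE pF FE.
have AESE S' : A S' -> A (fun y => E (S' (E y))).
  by move=> AS'; apply: (vna_comp _ hA) => //; exact: (vna_comp _ hA _ _ AS' AE).
have := abF _ _ (AESE _ AS) (AESE _ AT) x; rewrite !FE !EF.
by rewrite !(projE _ pE).
Qed.

Lemma vn_centerB Z Q : vn_center A Z -> vn_center A Q ->
  vn_center A (fun x => Z x - Q x).
Proof.
move=> cZ cQ; have [[AZ _] [AQ _]] := (cZ, cQ).
have AZQ := vnaB _ hA _ _ AZ AQ; split=> //; split; first exact: (vna_bop _ hA).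
move=> S AS; apply/funext => x /=.
by rewrite (centerE _ _ _ _ cZ AS) (centerE _ _ _ _ cQ AS) (linB _ (vna_lin _ hA _ AS)).
Qed.

Lemma vn_center_id : vn_center A (fun x => x).
Proof. by have h := vna_id _ hA; split=> //; split=> //; exact: (vna_bop _ hA). Qed.

Lemma projection_id : projection (fun x : H => x).
Proof. by apply/projectionP; split=> //; exact: (vna_bop _ hA _ (vna_id _ hA)). Qed.

(* [1 - Q] projects onto the vectors annihilated by [E A], so [Q] is the central
   support of [E]. *)
Lemma central_support E : A E -> projection E -> exists Q,
  [/\ vn_center A Q, projection Q, forall x, Q (E x) = E x,
      forall x, (forall T, A T -> E (T x) = 0) -> Q x = 0
    & forall x, Q x = x -> forall y, (forall T, A T -> E (T y) = 0) -> rip x y = 0].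
Proof.
move=> AE pE; pose N x := forall T, A T -> E (T x) = 0.
have AET T : A T -> A (fun x => E (T x)) by exact: (vna_comp _ hA _ _ AE).
have cN : csub N.
  split.
    split=> [T AT|c x y hx hy T AT]; first exact: (lin0 _ (vna_lin _ hA _ (AET _ AT))).
    by rewrite (vna_lin _ hA _ (AET _ AT)) hx// hy// scaler0 addr0.
  move=> x hx T AT; apply: (ker_csub _ (vna_bop _ hA _ (AET _ AT))).2 => e e0.
  by have [y [Ny xy]] := hx _ e0; exists y; split=> //; exact: Ny.
have [cP pP] : vn_center A (proj N) /\ projection (proj N).
  apply: center_proj => //.
    move=> S cS x Nx T AT; rewrite -(commE _ _ _ _ cS AT) -(commE _ _ _ _ cS AE) Nx//.
    by rewrite (lin0 S)//; case: (comm_bop _ _ cS).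
  by move=> S AS x Nx T AT; apply: (Nx (fun x => T (S x))); exact: (vna_comp _ hA).
exists (fun x => x - proj N x); split.
- exact: (vn_centerB _ _ vn_center_id cP).
- exact: (projection_sub _ _ pP projection_id).
- move=> x; rewrite proj_eq0 ?subr0// => k Nk.
  by rewrite (projA _ pE) (Nk id (vna_id _ hA)) rip0r.
- by move=> x Nx; rewrite proj_id ?subrr.
- move=> x Qx; apply: (proj0_orth _ cN).
  by rewrite -Qx (linB _ (proj_linear _ cN)) proj_idem// subrr.
Qed.

Variable b : H -> H.
Hypothesis Ab : A b.
Hypothesis bs : radj b b.
Hypothesis b2 : forall x, rip (b x) (b x) <= rip (b x) x.
Hypothesis b0 : forall x, b x = 0 -> x = 0.
Hypothesis hfin : finite_algebra A.

Lemma embeds_contr F P V W x : projection F -> embeds A F P V W ->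
  rip (W x) (W x) <= rip x x.
Proof.
move=> pF [AV AW aVW WV _]; rewrite !rip_nm ler_sqr ?nnegrE ?nm_ge0//.
apply: (adj_contraction _ _ aVW) => y; apply: nm_le_sq; first exact: nm_ge0.
rewrite aVW WV -rip_nm -(projE _ pF) -(projA _ pF) !rip_nm.
by rewrite ler_sqr ?nnegrE ?nm_ge0// projection_nm.
Qed.

(* Let [E <= F] be as in [comparison] for the remainder [P] of a finite family of
   copies [U i] of [F]. If [E] embedded by [V] into a cut [C] at level [e], then for
   [k = E k], commutativity of [F A F] gives
   [|k|^2 = |V k|^2 = \sum_i |(U i)^* V k|^2 = \sum_i |V^* (U i) k|^2
     <= \sum_i |C (U i) k|^2], which is less than [|k|^2] for small [e]. Hence some
   nonzero [E1 <= E] satisfies [C A E1 = 0], and the gap holds on the central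
   support of [E1]. *)
Lemma central_gap F : A F -> projection F -> abelian A F -> (exists x, F x <> 0) ->
  exists Q (e : R), [/\ vn_center A Q, projection Q, exists x, Q (F x) <> 0, 0 < e
    & forall x, Q x = x -> e * rip x x <= rip (b x) x] /\
    forall Z, vn_center A Z -> projection Z -> (forall x, Z (F x) = F x) ->
      forall x, Z (Q x) = Q x.
Proof.
move=> AF pF abF F0.
have [n [P [U [W [AP pP UW eP nP]]]]] := finite_multiplicity A hA hfin F AF pF F0.
(* [nP] excludes an embedding of [F] in the rest [P]. The other alternative, [P A E = 0], places
   [V k] inside the finitely many copies for every [V] in [A]. *)
have [//|[E [AE pE [x0 Ex0] FE PE]]] := comparison A hA F P AF pF abF AP pP.
have abE := abelian_sub _ _ AE pE pF FE abF.
pose k := E x0.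
have k0 : 0 < rip k k.
  by rewrite lt_neqAle rip_ge0 andbT eq_sym; apply/eqP => /rip_eq0.
have [e [e0 he]] := cut_small A hA b Ab bs b0 n (fun i => U i k) _ k0.
have [C [AC cC]] := cut_exists A hA b Ab bs b2 e.
have {}he := he e C (lexx _) cC; have [pC _ hC] := cC.
have [[V [W' em]]|] := comparison A hA E C AE pE abE AC pC.
  exfalso; have [AV AW' aVW WV CV] := em.
  have Ek : E k = k by rewrite /k projE.
  have Fk : F k = k by rewrite -Ek FE.
  have VF x : V (F x) = V x.
    rewrite -(embeds_r _ hA _ _ _ _ (F x) pE em) -(embeds_r _ hA _ _ _ _ x pE em).
    by rewrite (proj_swap _ _ pE pF FE).
  have FW' x : F (W' x) = W' x by rewrite -(embeds_l _ hA _ _ _ _ x pE em) FE.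
  have : rip k k <= \sum_(i < n) rip (C (U i k)) (C (U i k)).
    have -> : rip k k = rip (V k) (V k) by rewrite aVW WV Ek.
    have {2}-> : V k = \sum_(i < n) U i (W i (V k)).
      by rewrite -eP -[in P _]Ek PE// subr0.
    have -> m : rip (V k) (\sum_(i < m) U i (W i (V k))) =
                \sum_(i < m) rip (V k) (U i (W i (V k))).
      elim: m => [|m IH]; first by rewrite !big_ord0 rip0r.
      by rewrite !big_ord_recr /= ripDr IH.
    apply: ler_sum => i _; have [AU AW aUW FW] := UW i (ltn_ord i).
    (* Exchanging [W' U i] with [W i V] in the corner turns [<V k, U i W i V k>] into
       [|W' (U i k)|^2]; then [W' = W' C] brings in the cut. *)
    have := abF _ _ (vna_comp _ hA _ _ AW' AU) (vna_comp _ hA _ _ AW AV) k.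
    rewrite Fk !FW' !FW => h.
    rewrite aVW h -aUW -(adj_sym _ _ aVW) -(embeds_W _ _ _ _ _ (U i k) pC em).
    exact: (embeds_contr _ _ _ _ _ pE em).
  by lra.
move=> [E1 [AE1 pE1 [x1 h1] EE1 CE1]].
have FE1 x : F (E1 x) = E1 x by rewrite -EE1 FE.
have [Q [cQ pQ QE1 NQ QN]] := central_support _ AE1 pE1.
exists Q, e; split; first split=> //.
- by exists (E1 x1); rewrite FE1 QE1.
(* Taking adjoints in [C A E1 = 0] shows that [E1 A] annihilates [C x]. Vectors fixed by [Q] are
   orthogonal to such vectors, so [C x = 0] and the lower bound of the cut applies. *)
- move=> x Qx; apply: hC; apply: rip_eq0; rewrite (projA _ pC) projE//.
  apply: QN => // T AT; have [T' [AT' TT']] := vna_adj _ hA _ AT.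
  apply: rip_inj => z.
  by rewrite (projA _ pE1) TT' (projA _ pC) CE1// rip0r rip0l.
- move=> Z cZ pZ ZF x; have [AQ _] := cQ.
  rewrite (centerE _ _ _ _ cZ AQ); apply/subr0_eq.
  rewrite -(linB _ (projL _ pQ)); apply: NQ => T AT.
  have lT := vna_lin _ hA _ AT; rewrite (linB _ lT) -(centerE _ _ _ _ cZ AT).
  rewrite (linB _ (projL _ pE1)) (proj_swap _ _ pE1 pZ) ?subrr// => y.
  by rewrite -FE1 ZF.
Qed.

End CentralGap.

(** * The central decomposition *)

Section OperatorNorm.
Context {R : realType} {H : hilbertType R}.
Implicit Types (x y : H) (T : H -> H).

Let unit_ball x : `|x| <= 1 <-> nm x <= 1.
Proof. by rewrite normE -lecR. Qed.

Lemma opnormP T x : bounded_operator T -> nm (T x) <= opnorm T * nm x.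
Proof.
move=> /bopP[l [M [M0 hM]]].
have hs : has_sup [set complex.Re `|T x| | x in [set x : H | `|x| <= 1]]%classic.
  split; first by exists (nm (T 0)), 0 => //=; rewrite normr0 ler01.
  exists M => _ [y /= /unit_ball y1 <-]; apply: le_trans (hM y) _.
  by rewrite ler_piMr.
have [->|x0] := pselect (x = 0); first by rewrite (lin0 _ l) nm0 mulr0.
have n0 : 0 < nm x.
  by rewrite lt_neqAle nm_ge0 andbT eq_sym; apply/eqP => /nm_eq0.
rewrite -ler_pdivrMr//; apply: ub_le_sup; first exact: hs.2.
exists ((nm x)^-1%:C%C *: x) => /=.
  by apply/unit_ball; rewrite nmZ ger0_norm ?invr_ge0 ?nm_ge0// mulVf// gt_eqF.
rewrite (linZ _ l) -/(nm _) nmZ ger0_norm ?invr_ge0 ?nm_ge0//; exact: mulrC.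
Qed.

Lemma opnorm_le T (c : R) : linear T -> 0 <= c ->
  (forall x, nm (T x) <= c * nm x) -> opnorm T <= c.
Proof.
move=> l c0 h; apply: ge_sup.
  by exists (nm (T 0)), 0 => //=; rewrite normr0 ler01.
move=> _ [y /= /unit_ball y1 <-]; apply: le_trans (h y) _.
by rewrite ler_piMr.
Qed.

End OperatorNorm.

Section Decomposition.
Context {R : realType} {H : hilbertType R} (A : set (H -> H)).
Hypothesis hA : von_neumann_algebra A.
Variable T : H -> H.
Hypothesis AT : A T.
Implicit Types (x y z : H) (Q : H -> H).

(** A limit of strict inequalities is not strict. Since [T] commutes with the [Z n], it keeps the
    components orthogonal, and the deficit [g k > 0] of one non-zero component survives in all later
    partial sums. *)
Lemma strict_of_decomposition (Z : nat -> H -> H) :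
  (forall n, vn_center A (Z n) /\ projection (Z n)) ->
  (forall m n, m <> n -> Z m \o Z n = 0) -> sot_sum Z idfun ->
  (forall n, opnorm (T \o Z n) < 1) -> forall x, x <> 0 -> `|T x| < `|x|.
Proof.
move=> cZ oZ sZ nZ x x0; rewrite !normE ltcR.
have lT := vna_lin _ hA _ AT.
have hs : lims (series (fun n => Z n x)) x by apply/lims_cvg; exact: sZ.
set s := series _ in hs.
have s0 : s 0%N = 0 by rewrite /s /series /= big_geq.
have sS n : s n.+1 = s n + Z n x by rewrite /s /series /= big_nat_recr.
have lZ n := projL _ (cZ n).2.
have Zs n m : (n <= m)%N -> Z m (s n) = 0.
  elim: n => [|n IH] nm; first by rewrite s0 (lin0 _ (lZ m)).
  rewrite sS (linD _ (lZ m)) IH ?add0r ?(ltnW nm)//.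
  have nmn : m <> n by move=> e; rewrite e ltnn in nm.
  by have /(congr1 (@^~ x)) := oZ _ _ nmn.
pose g n := rip (Z n x) (Z n x) - rip (T (Z n x)) (T (Z n x)).
have gle n : nm (T (Z n x)) <= opnorm (T \o Z n) * nm (Z n x).
  rewrite -{1}(projE _ (cZ n).2); apply: (opnormP (T \o Z n)).
  by apply: bop_comp; [exact: (vna_bop _ hA _ AT)|exact: proj_bounded (cZ n).2].
have gpos n : Z n x <> 0 -> 0 < g n.
  move=> z0; have n0 : 0 < nm (Z n x).
    by rewrite lt_neqAle nm_ge0 andbT eq_sym; apply/eqP => /nm_eq0.
  rewrite /g subr_gt0 !rip_nm ltr_sqr ?nnegrE ?nm_ge0//.
  by apply: le_lt_trans (gle n) _; rewrite gtr_pMl.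
have gge n : 0 <= g n.
  have [e|/gpos/ltW//] := pselect (Z n x = 0).
  by rewrite /g e (lin0 _ lT) subrr.
have [k gk] : exists k, 0 < g k.
  apply: contrapT => h; apply: x0; apply: (lims_unique _ _ _ hs).
  rewrite (_ : s = fun=> 0); first exact: lims_cst.
  apply/funext; elim=> // n IH; rewrite sS IH add0r.
  by apply: contrapT => /gpos ?; apply: h; exists n.
have split n : rip (s n) (s n) = rip (T (s n)) (T (s n)) + \sum_(i < n) g i.
  elim: n => [|n IH]; first by rewrite s0 (lin0 _ lT) big_ord0 addr0.
  have [[_ pZ] e0] := (cZ n, Zs n n (leqnn n)).
  rewrite sS (linD _ lT) !ripDl !ripDr IH big_ord_recr /= /g.
  have -> : rip (s n) (Z n x) = 0 by rewrite -(projA _ pZ) e0 rip0l.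
  have e1 : rip (T (s n)) (T (Z n x)) = 0.
    rewrite -(centerE _ _ _ _ (cZ n).1 AT) -(projA _ pZ).
    by rewrite (centerE _ _ _ _ (cZ n).1 AT) e0 (lin0 _ lT) rip0l.
  have e2 : rip (Z n x) (s n) = 0 by rewrite (projA _ pZ) e0 rip0r.
  by rewrite (ripC (T (Z n x)) (T (s n))) e1 e2; ring.
have sx n : nm (s n) <= nm x.
  have e : rip (s n) x = rip (s n) (s n).
    elim: n => [|n IH]; first by rewrite s0 !rip0l.
    have [[_ pZ] e0] := (cZ n, Zs n n (leqnn n)).
    have c : rip (s n) (Z n x) = 0 by rewrite -(projA _ pZ) e0 rip0l.
    have d : rip (Z n x) x = rip (Z n x) (Z n x).
      by rewrite [RHS](projA _ pZ) projE// (projA _ pZ).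
    by rewrite sS !ripDl !ripDr IH d (ripC (Z n x) (s n)) c; ring.
  have [h|h] := leP (nm (s n)) 0; first exact: le_trans h (nm_ge0 _).
  rewrite -(ler_pM2l h) -expr2 -rip_nm -e; exact: rip_CS.
have ge n : (k < n)%N -> nm (T (s n)) ^+ 2 <= nm x ^+ 2 - g k.
  move=> kn; have := split n; rewrite (bigD1 (Ordinal kn))//= !rip_nm.
  have : 0 <= \sum_(i < n | i != Ordinal kn) g i by apply: sumr_ge0.
  have : nm (s n) ^+ 2 <= nm x ^+ 2 by rewrite ler_sqr ?nnegrE ?nm_ge0.
  lra.
have d0 : 0 <= nm x ^+ 2 - g k := le_trans (sqr_ge0 _) (ge _ (ltnSn k)).
pose r := Num.sqrt (nm x ^+ 2 - g k).
have rx : r < nm x.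
  by rewrite -ltr_sqr ?nnegrE ?sqrtr_ge0 ?nm_ge0// sqr_sqrtr//; lra.
apply: le_lt_trans rx; have bT := vna_bop _ hA _ AT.
have hTs := lims_bop _ _ _ bT hs.
(* The index is shifted by [k + 1] because the bound holds only past [k]. *)
apply: (lims_nm (fun n => T (s (n + k.+1)%N))) => [e e0|n].
  by have [n hn] := hTs _ e0; exists n => p np; apply: hn; rewrite (leq_trans np)// leq_addr.
apply: nm_le_sq; first exact: sqrtr_ge0.
by rewrite sqr_sqrtr// rip_nm ge// leq_addl.
Qed.

Definition gap_level (k : nat) : R := 1 - k.+1%:R^-1.

Definition gap_vectors k x := exists Q, [/\ vn_center A Q, projection Q,
  forall y, rip (T (Q y)) (T (Q y)) <= gap_level k * rip (Q y) (Q y) & Q x = x].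

Lemma vn_centerP Q : A Q -> (forall S, A S -> forall x, Q (S x) = S (Q x)) ->
  vn_center A Q.
Proof.
move=> AQ h; split=> //; split; first exact: (vna_bop _ hA).
by move=> S AS; apply/funext => x /=; exact: h.
Qed.

Lemma gap_level_ge0 k : 0 <= gap_level k.
Proof. by rewrite subr_ge0 invf_le1// ler1n. Qed.

Lemma gap_level_le k m : (k <= m)%N -> gap_level k <= gap_level m.
Proof. by move=> km; rewrite lerD2l lerN2 lef_pV2 ?posrE// ler_nat. Qed.

Lemma gap_vectors_le k m x : (k <= m)%N -> gap_vectors k x -> gap_vectors m x.
Proof.
move=> km [Q [cQ pQ hQ Qx]]; exists Q; split=> // y; apply: le_trans (hQ y) _.
by rewrite ler_wpM2r ?rip_ge0 ?gap_level_le.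
Qed.

(** The join [P + Q (1 - P)] of two central projections inherits their common bound, its summands
    being orthogonal and respected by [T]. So the union of the ranges is already a subspace. *)
Lemma gap_vectors_subsp k : subsp (gap_vectors k).
Proof.
have lT := vna_lin _ hA _ AT.
split.
  (* The zero projection, written as [1 - 1] so that closure under differences applies. *)
  exists (fun x => x - x); split; last by rewrite subrr.
  - exact: (vn_centerB _ hA _ _ (vn_center_id _ hA) (vn_center_id _ hA)).
  - have p := projection_id A hA; exact: projection_sub.
  - by move=> y; rewrite subrr (lin0 _ lT) rip0l mulr0.
move=> c x x' [P [cP pP hP Px]] [Q [cQ pQ hQ Qx']].
have [[AP _] [AQ _]] := (cP, cQ).
have [lP lQ] := (projL _ pP, projL _ pQ).
have PQ y : P (Q y) = Q (P y) by exact: (centerE _ _ _ _ cP AQ).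
have AE : A (fun y => P y + Q (y - P y)).
  apply: (vnaD _ hA) => //; apply: (vna_comp _ hA) => //.
  exact: (vnaB _ hA _ _ (vna_id _ hA) AP).
have P1 y : P (y - P y) = 0 by rewrite (linB _ lP) projE// subrr.
have PT := centerE _ _ _ _ cP AT.
have cross (y z : H) : P y = y -> P z = 0 -> rip y z = 0.
  by move=> e e'; rewrite -e (projA _ pP) e' rip0r.
exists (fun y => P y + Q (y - P y)); split.
- apply: vn_centerP => // S AS y; have lS := vna_lin _ hA _ AS.
  rewrite (centerE _ _ _ _ cP AS) -(linB _ lS) (centerE _ _ _ _ cQ AS).
  by rewrite (linD _ lS).
- apply/projectionP; split; first exact: (vna_bop _ hA _ AE).
    move=> y; rewrite (linD _ lP) projE// PQ P1 (lin0 _ lQ) addr0.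
    by rewrite [P y + _ - _]addrAC subrr add0r projE.
  move=> y z; rewrite !ripDl !ripDr (projA _ pQ) (projA _ pP) !ripBl.
  by rewrite (linB _ lQ) !ripBr (projA _ pP) PQ.
- move=> y; rewrite (linD _ lT) !ripDl !ripDr.
  set w := y - P y.
  have e1 : rip (P y) (Q w) = 0 by apply: cross; rewrite ?projE// PQ P1 (lin0 _ lQ).
  have e2 : rip (T (P y)) (T (Q w)) = 0.
    apply: cross; rewrite PT ?projE//.
    by rewrite PQ P1 (lin0 _ lQ) (lin0 _ lT).
  rewrite (ripC (Q w)) (ripC (T (Q w))) e1 e2.
  by have := hP y; have := hQ w; lra.
- have E x1 : P x1 = x1 -> P x1 + Q (x1 - P x1) = x1.
    by move=> ->; rewrite subrr (lin0 _ lQ) addr0.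
  have E' x1 : Q x1 = x1 -> P x1 + Q (x1 - P x1) = x1.
    by move=> e; rewrite (linB _ lQ) -PQ e addrC subrK.
  have lE := vna_lin _ hA _ AE.
  by rewrite (linD _ lE) (linZ _ lE) E// E'.
Qed.

Let K k := adh (gap_vectors k).
Let cK k : csub (K k) := adh_subsp _ (gap_vectors_subsp k).

Lemma gap_vectors_cinv k : cinv A (gap_vectors k).
Proof.
move=> S cS x [Q [cQ pQ hQ Qx]]; exists Q; split=> //.
by have [AQ _] := cQ; rewrite -(commE _ _ _ _ cS AQ) Qx.
Qed.

Lemma gap_vectors_ainv k : ainv A (gap_vectors k).
Proof.
move=> S AS x [Q [cQ pQ hQ Qx]]; exists Q; split=> //.
by rewrite (centerE _ _ _ _ cQ AS) Qx.
Qed.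

Lemma ainv_adh (D : H -> Prop) : ainv A D -> ainv A (adh D).
Proof.
move=> iD S AS x /lims_adh[u [Du hu]].
apply: (adh_lims _ _ (fun n => S (u n))); first by move=> n; apply: iD.
exact: (lims_bop _ _ _ (vna_bop _ hA _ AS) hu).
Qed.

Lemma adh_center (D : H -> Prop) : subsp D -> cinv A D -> ainv A D ->
  vn_center A (proj (adh D)) /\ projection (proj (adh D)).
Proof.
move=> sD cD aD; apply: (center_proj _ hA); first exact: adh_subsp.
  exact: cinv_adh.
exact: ainv_adh.
Qed.

Lemma gap_bound k x : K k x -> nm (T x) <= Num.sqrt (gap_level k) * nm x.
Proof.
move=> /lims_adh[u [Mu hu]].
have := lims_nm_le (fun n => T (u n)) (fun n => (Num.sqrt (gap_level k))%:C%C *: u n)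
  (T x) ((Num.sqrt (gap_level k))%:C%C *: x).
rewrite nmZ ger0_norm ?sqrtr_ge0//; apply.
- exact: (lims_bop _ _ _ (vna_bop _ hA _ AT) hu).
- apply: (lims_le u _ _ _ (Num.sqrt (gap_level k)) (sqrtr_ge0 _) hu) => n.
  by rewrite -scalerBr nmZ ger0_norm ?sqrtr_ge0.
- move=> n; rewrite nmZ ger0_norm ?sqrtr_ge0//.
  apply: nm_le_sq; first by rewrite mulr_ge0 ?sqrtr_ge0 ?nm_ge0.
  rewrite exprMn sqr_sqrtr ?gap_level_ge0// -rip_nm.
  by have [Q [_ _ hQ e]] := Mu n; have := hQ (u n); rewrite e.
Qed.

Hypothesis hfin : finite_algebra A.
Hypothesis hI : type_I A.
Hypothesis hT : forall x, x <> 0 -> `|T x| < `|x|.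

Let T_nm x : nm (T x) <= nm x.
Proof.
have [->|/hT] := pselect (x = 0); first by rewrite (lin0 _ (vna_lin _ hA _ AT)).
by rewrite !normE ltcR => /ltW.
Qed.

(** Otherwise the projection [Z] on the orthogonal complement is central and non-zero, and type I
    gives an abelian [F] below it. The resulting [Q] lies below [Z], yet its range consists of gap
    vectors, which [Z] kills. *)
Lemma gap_dense x : adh (fun y => exists k, gap_vectors k y) x.
Proof.
set D := fun y => _.
have sD : subsp D.
  split; first by exists 0%N; case: (gap_vectors_subsp 0).
  move=> c y y' [k hk] [k' hk']; exists (maxn k k').
  case: (gap_vectors_subsp (maxn k k')) => _; apply.
    exact: (gap_vectors_le _ _ _ (leq_maxl k k') hk).
  exact: (gap_vectors_le _ _ _ (leq_maxr k k') hk').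
have [cE pE] : vn_center A (proj (adh D)) /\ projection (proj (adh D)).
  apply: adh_center => //.
    by move=> S cS y [k hk]; exists k; exact: gap_vectors_cinv.
  by move=> S AS y [k hk]; exists k; exact: gap_vectors_ainv.
have cD := adh_subsp _ sD.
pose Z y := y - proj (adh D) y.
have cZ : vn_center A Z by exact: (vn_centerB _ hA _ _ (vn_center_id _ hA) cE).
have pZ : projection Z by exact: (projection_sub _ _ pE (projection_id A hA)).
have [Z0|/hI] := pselect (Z = 0).
  have /subr0_eq -> : Z x = 0 by rewrite Z0.
  exact: projK_in.
move=> /(_ cZ pZ)[F [abF ZF /fun_neq0 F0]].
have [AF pF _] := abF; have {}abF := abelian_projectionP _ _ abF.
have ZF' y : Z (F y) = F y by have /(congr1 (@^~ y)) := ZF.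
have [T' [AT' TT']] := vna_adj _ hA _ AT.
have lT := vna_lin _ hA _ AT.
pose b y := y - T' (T y).
have Ab : A b by exact: (vnaB _ hA _ _ (vna_id _ hA) (vna_comp _ hA _ _ AT' AT)).
have br y : rip (b y) y = rip y y - rip (T y) (T y).
  by rewrite ripBl (adj_sym _ _ TT').
have bs : radj b b.
  by move=> y z; rewrite /b !ripBl !ripBr (adj_sym _ _ TT') TT'.
(* [|b y|^2 = |y|^2 - 2 |T y|^2 + |T' T y|^2], and [T'] is a contraction along with [T]. *)
have b2 y : rip (b y) (b y) <= rip (b y) y.
  have e : rip y (T' (T y)) = rip (T y) (T y) by rewrite -TT'.
  rewrite br /b !ripBl !ripBr (ripC (T' (T y)) y) e.
  have := adj_contraction _ _ TT' T_nm (T y).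
  rewrite -ler_sqr ?nnegrE ?nm_ge0// -!rip_nm; lra.
have b0 y : b y = 0 -> y = 0.
  move=> e; apply: contrapT => /hT; rewrite !normE ltcR.
  rewrite -ltr_sqr ?nnegrE ?nm_ge0// -!rip_nm.
  by have := br y; rewrite e rip0l => /esym/subr0_eq ->; rewrite ltxx.
have [Q [e [[cQ pQ [y QF] e0 hQ] ZQ]]] := central_gap A hA b Ab bs b2 b0 hfin F AF pF abF F0.
have {}ZQ := ZQ Z cZ pZ ZF'.
exfalso; apply: QF.
have [k hk] : exists k : nat, k.+1%:R^-1 <= e.
  exists (Num.truncn e^-1); rewrite invf_ple ?posrE//.
  exact/ltW/truncnS_gt.
have : D (Q (F y)).
  exists k, Q; split=> //; last by rewrite projE.
  move=> z; have := hQ _ (projE _ pQ z); rewrite br /gap_level => h.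
  by have := ler_wpM2r (rip_ge0 (Q z)) hk; rewrite mulrBl mul1r; move: (_^-1 * _) h => i; lra.
by move=> /adh_in Dy; rewrite -ZQ /Z (proj_id _ cD _ Dy) subrr.
Qed.

(** Starting from 0 with the index shifted by one, the partial sums of [Z] telescope to
    [cut_proj n], and the range of [Z n] lies in [K n]. *)
Let cut_proj n x : H := if n is m.+1 then proj (K m) x else 0.

Let cut_proj_center n : vn_center A (cut_proj n) /\ projection (cut_proj n).
Proof.
case: n => [|n]; last first.
  apply: adh_center; first exact: gap_vectors_subsp.
    exact: gap_vectors_cinv.
  exact: gap_vectors_ainv.
rewrite (_ : cut_proj 0 = fun x => x - x); last by apply/funext => x; rewrite subrr.
split; first exact: (vn_centerB _ hA _ _ (vn_center_id _ hA) (vn_center_id _ hA)).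
have p := projection_id A hA; exact: projection_sub.
Qed.

Let cut_proj_in n m x : (n <= m)%N -> cut_proj m (cut_proj n x) = cut_proj n x.
Proof.
case: m => [|m]; first by case: n.
case: n => [|n] nm /=; first by rewrite (lin0 _ (proj_linear _ (cK m))).
apply: proj_id => // e e0; have [y [My xy]] := projK_in _ (cK n) x e e0.
by exists y; split=> //; exact: (gap_vectors_le n m).
Qed.

Let cut_proj_in' n m x : (n <= m)%N -> cut_proj n (cut_proj m x) = cut_proj n x.
Proof.
move=> nm; have [[_ pn] [_ pm]] := (cut_proj_center n, cut_proj_center m).
by apply: (proj_swap _ _ pn pm) => y; exact: cut_proj_in.
Qed.

Let Z n x := cut_proj n.+1 x - cut_proj n x.

Lemma decomposition_of_strict : exists Z : nat -> H -> H,
     [/\ forall n, vn_center A (Z n) /\ projection (Z n),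
         forall m n, m <> n -> Z m \o Z n = 0,
         sot_sum Z idfun
       & forall n, opnorm (T \o Z n) < 1].
Proof.
have lc n := projL _ (cut_proj_center n).2.
have lT := vna_lin _ hA _ AT.
exists Z; split.
- move=> n; have [[c1 p1] [c2 p2]] := (cut_proj_center n.+1, cut_proj_center n).
  split; first exact: (vn_centerB _ hA).
  by apply: projection_sub => // x; exact: cut_proj_in.
- move=> m n mn; apply/funext => x.
  rewrite -[LHS]/(cut_proj m.+1 (cut_proj n.+1 x - cut_proj n x) -
                  cut_proj m (cut_proj n.+1 x - cut_proj n x)).
  rewrite !(linB _ (lc _)); have [lt|gt|//] := ltngtP m n.
    have [l1 l2] := (ltnW lt, leqW (ltnW lt)).
    by rewrite !cut_proj_in' ?subrr.
  have [l1 l2] := (ltnW gt, leqW (ltnW gt)).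
  by rewrite !cut_proj_in ?subrr.
(* On the dense set of gap vectors the partial sums are eventually the identity; being contractions,
   they converge strongly everywhere. *)
- move=> x; apply/lims_cvg => e e0.
  have e20 := divr_gt0 e0 (ltr0n _ 2); have [y [[k My] xy]] := gap_dense x _ e20.
  exists k.+1 => n kn.
  have -> : series (fun n => Z n x) n = cut_proj n x.
    elim: (n) => [|m IH]; first by rewrite /series /= big_geq.
    rewrite /series /= big_nat_recr//= -/(series (fun n => Z n x) m) in IH *.
    by rewrite IH /Z addrC subrK.
  have cy : cut_proj n y = y.
    case: n kn => // n kn; apply: proj_id => //; apply: adh_in.
    exact: (gap_vectors_le k n).
  have := nm_triangle (cut_proj n x) (cut_proj n y) x.
  rewrite -(linB _ (lc n)) cy (nmB y).
  by have := projection_nm _ (x - y) (cut_proj_center n).2; lra.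
- move=> n; apply: (@le_lt_trans _ _ (Num.sqrt (gap_level n))).
    apply: opnorm_le; [|exact: sqrtr_ge0|] => [c x y|x] /=.
      by rewrite /Z !lc -lT scalerBr opprD addrACA.
    have [[_ p1] [_ p2]] := (cut_proj_center n.+1, cut_proj_center n).
    have pZ : projection (Z n) by apply: projection_sub => // z; exact: cut_proj_in.
    apply: le_trans (gap_bound n _ _) _.
      apply: (subspB _ (cK n)); first exact: (projK_in _ (cK n)).
      rewrite -(cut_proj_in _ _ _ (leqnSn n)); exact: (projK_in _ (cK n)).
    by rewrite ler_wpM2l ?sqrtr_ge0// projection_nm.
  rewrite -(ltr_sqr (sqrtr_ge0 _) ler01) expr1n sqr_sqrtr ?gap_level_ge0//.
  by rewrite /gap_level ltrBlDr ltrDl invr_gt0.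
Qed.

End Decomposition.

Theorem theorem2p1 (R : realType) (H : hilbertType R) (A : set (H -> H))
    (hA : von_neumann_algebra A) (hfin : finite_algebra A) (hI : type_I A)
    (T : H -> H) (hT : A T) :
  (forall x : H, x <> 0 -> `|T x| < `|x|) <->
  (exists Z : nat -> H -> H,
     [/\ forall n, vn_center A (Z n) /\ projection (Z n),
         forall m n, m <> n -> Z m \o Z n = 0,
         sot_sum Z idfun
       & forall n, opnorm (T \o Z n) < 1]).
Proof.
split=> [h|[Z [cZ oZ sZ nZ]]]; first exact: (decomposition_of_strict A hA T hT).
exact: (strict_of_decomposition A hA T hT Z).
Qed.
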